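(* Let $q$ be a power of an odd prime, let $g$ be a primitive element of $\mathbb F_q$ (a generator of $\mathbb F_q^*$), let $d=4k+1$ with $k$ a positive integer, and let $S_g=\{x\in\mathbb F_q^d: x_1^2+\cdots+x_d^2=g\}$. Then \[R^*_{S_g}\left(\frac{4d}{3d-2}\to 4\right)\ll 1.\]
   Context: $\chi$ is a fixed nontrivial additive character of $\mathbb F_q$. For $V\subset\mathbb F_q^d$ and $f:V\to\mathbb C$, $(fd\sigma)^\vee(m)=\frac{1}{|V|}\sum_{x\in V}\chi(m\cdot x)f(x)$, $\|F\|_{L^r(\mathbb F_q^d,dc)}=(\sum_{m\in\mathbb F_q^d}|F(m)|^r)^{1/r}$, $\|f\|_{L^p(V,d\sigma)}=(\frac1{|V|}\sum_{x\in V}|f(x)|^p)^{1/p}$, and $R_V^*(p\to r)$ is the smallest constant such that $\|(fd\sigma)^\vee\|_{L^r(\mathbb F_q^d,dc)}\le R_V^*(p\to r)\|f\|_{L^p(V,d\sigma)}$ for all $f$. $X\ll 1$ means bounded by a constant independent of $q$. *)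

(* Defs.v *)
From mathcomp Require Import all_boot all_algebra.
From mathcomp Require Import reals exp.
From mathcomp Require Import complex.
Import GRing.Theory Num.Theory.
Local Open Scope ring_scope.

Set Implicit Arguments.
Unset Strict Implicit.
Unset Printing Implicit Defensive.

Definition dotv (F : fieldType) (d : nat) (m x : 'rV[F]_d) : F :=
  \sum_(i < d) m 0 i * x 0 i.

Definition nontrivial_additive_char (R : realType) (F : finFieldType)
    (chi : F -> R[i]) : Prop :=
  chi 0 = 1 /\ (forall a b : F, chi (a + b) = chi a * chi b) /\
  exists a : F, chi a != 1.

Definition sphere (F : finFieldType) (d : nat) (g : F) : {set 'rV[F]_d} :=
  [set x : 'rV[F]_d | \sum_(i < d) x 0 i ^+ 2 == g].

Definition ext_op (R : realType) (F : finFieldType) (d : nat) (chi : F -> R[i])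
    (V : {set 'rV[F]_d}) (f : 'rV[F]_d -> R[i]) (m : 'rV[F]_d) : R[i] :=
  (#|V|%:R)^-1 * \sum_(x in V) chi (dotv m x) * f x.

Definition norm_dc (R : realType) (F : finFieldType) (d : nat) (r : R)
    (G : 'rV[F]_d -> R[i]) : R :=
  (\sum_(m : 'rV[F]_d) (Normc.normc (G m)) `^ r) `^ (r^-1).

Definition norm_dsigma (R : realType) (F : finFieldType) (d : nat) (p : R)
    (V : {set 'rV[F]_d}) (f : 'rV[F]_d -> R[i]) : R :=
  ((#|V|%:R)^-1 * \sum_(x in V) (Normc.normc (f x)) `^ p) `^ (p^-1).

(* Main.v *)
(** Write d = 4k+1, p = 4d/(3d-2), S = S_g. The fourth moment of the Fourier
    transform of f on S is q^d times a sum over the rectangles (a, c, b, a+b-c)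
    inscribed in S. With x = |f|^(4/(3d-2)), u = x^(d-1) and v = x^d = |f|^p we
    have u^2 v = |f|^4, so AM-GM over the symmetries of a rectangle bounds the
    product of the four values by u u v at three of the vertices, where we may
    choose which vertex receives v.

    Rectangles with an isotropic side a - c (that is, a.c = g) are counted by
    giving u to both ends of that side. The pairs (a, c) are controlled by the
    quadratic form x.x - g t^2 in d+1 = 4k+2 variables: as g is a nonsquare, it
    is elliptic, and the sign of its Gauss sum turns the positivity of a sum of
    squares over its cone into an upper bound. In the other rectangles, v is put
    at the vertex c; then the lines spanned by the vectors a - c are distinct,
    and the orthogonality relation between lines of F^d is quasirandom.

    Both bounds together give
    sum over rectangles << sum v * ((sum u)^2 / q + q^((d-2)/2) * sum u^2).
    It is applied to the part of f where x is at most a threshold l, and the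
    trivial bound sum v * (sum u)^2 to the rest; l is chosen to balance the two,
    and Hoelder's inequality bounds sum u. *)
Require Import Defs.
From mathcomp Require Import all_boot all_order all_algebra finfield.
From mathcomp Require Import reals exp.
From mathcomp Require Import complex.
From mathcomp Require Import zify ring lra.
Import Order.TTheory GRing.Theory Num.Theory.
Local Open Scope ring_scope.

Set Implicit Arguments.
Unset Strict Implicit.
Unset Printing Implicit Defensive.

(** * The dot product *)

Section DotProduct.
Variables (F : finFieldType) (d : nat).
Implicit Types (a b c m x y z : 'rV[F]_d) (s t : F).

Lemma dotvC x y : dotv x y = dotv y x.
Proof. by apply: eq_bigr => i _; rewrite mulrC. Qed.

Lemma dotvDr x y z : dotv x (y + z) = dotv x y + dotv x z.
Proof. by rewrite -big_split; apply: eq_bigr => i _; rewrite mxE mulrDr. Qed.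

Lemma dotvZr s x y : dotv x (s *: y) = s * dotv x y.
Proof. by rewrite mulr_sumr; apply: eq_bigr => i _; rewrite mxE mulrCA. Qed.

Lemma dotvNr x y : dotv x (- y) = - dotv x y.
Proof. by rewrite -scaleN1r dotvZr mulN1r. Qed.

Lemma dotvBr x y z : dotv x (y - z) = dotv x y - dotv x z.
Proof. by rewrite dotvDr dotvNr. Qed.

Lemma dotvDl x y z : dotv (x + y) z = dotv x z + dotv y z.
Proof. by rewrite !(dotvC _ z) dotvDr. Qed.

Lemma dotvZl s x y : dotv (s *: x) y = s * dotv x y.
Proof. by rewrite !(dotvC _ y) dotvZr. Qed.

Lemma dotvNl x y : dotv (- x) y = - dotv x y.
Proof. by rewrite !(dotvC _ y) dotvNr. Qed.

Lemma dotvBl x y z : dotv (x - y) z = dotv x z - dotv y z.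
Proof. by rewrite !(dotvC _ z) dotvBr. Qed.

Lemma dotv0 x : dotv x 0 = 0.
Proof. by rewrite -(scale0r x) dotvZr mul0r. Qed.

Lemma dotv_delta (i : 'I_d) x : dotv (delta_mx 0 i) x = x 0 i.
Proof.
rewrite /dotv (bigD1 i) //= big1 ?addr0 => [|j ji]; rewrite mxE ?eqxx ?mul1r //.
by rewrite (negPf ji) mul0r.
Qed.

Lemma in_sphere g x : (x \in sphere d g) = (dotv x x == g).
Proof. by rewrite inE. Qed.

End DotProduct.

Definition dotvE := (dotvDl, dotvDr, dotvBl, dotvBr, dotvNl, dotvNr, dotvZl, dotvZr).

Lemma card_finField_natr_gt1 (R : numDomainType) (F : finFieldType) :
  1 < #|F|%:R :> R.
Proof. by rewrite ltr1n finNzRing_gt1. Qed.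

Lemma finField_two_neq0 (F : finFieldType) : odd #|F| -> 2 != 0 :> F.
Proof.
apply: contraTN => two0.
have F2 : 2%N \in [pchar F] by rewrite inE /= two0.
have := finNzRing_gt1 F; rewrite (card_pprimeChar F2).
by case: logn => // n _; rewrite oddX.
Qed.

(** * Additive characters of a finite field *)

Section Characters.
Variables (C : numClosedFieldType) (F : finFieldType) (chi : F -> C).
Hypotheses (chi0 : chi 0 = 1) (chiD : forall a b, chi (a + b) = chi a * chi b).
Hypothesis chi_neq1 : exists a, chi a != 1.
Local Notation q := (#|F|%:R : C).

Lemma sum_nontrivial_char (V : finZmodType) (psi : V -> C) :
  (forall a b, psi (a + b) = psi a * psi b) -> (exists a, psi a != 1) ->
  \sum_a psi a = 0.
Proof.
move=> psiD [a psia]; apply/eqP.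
have /eqP : \sum_x psi x = psi a * \sum_x psi x.
  rewrite {1}(reindex_inj (addrI a)) mulr_sumr.
  by apply: eq_bigr => x _; rewrite psiD.
by rewrite -subr_eq0 -{1}(mul1r (\sum_x _)) -mulrBl mulf_eq0 subr_eq0 eq_sym (negPf psia).
Qed.

Lemma sum_char w : \sum_s chi (s * w) = q * (w == 0)%:R.
Proof.
have [-> | w0] := eqVneq w 0; last first.
  rewrite mulr0; apply: sum_nontrivial_char => [a b|]; first by rewrite mulrDl chiD.
  by have [a ca] := chi_neq1; exists (a / w); rewrite divfK.
rewrite (eq_bigr (fun=> 1)) => [|s _]; last by rewrite mulr0 chi0.
by rewrite sumr_const cardT -cardE mulr1.
Qed.

Lemma sum_char_neq0 w : \sum_(s | s != 0) chi (s * w) = q * (w == 0)%:R - 1.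
Proof. by rewrite -sum_char [in RHS](bigD1 0) //= mul0r chi0 addrAC subrr add0r. Qed.

Lemma sum_char_dotv d (w : 'rV[F]_d) :
  \sum_z chi (dotv z w) = q ^+ d * (w == 0)%:R.
Proof.
have [-> | w0] := eqVneq w 0; last first.
  rewrite mulr0; apply: sum_nontrivial_char => [a b|]; first by rewrite dotvDl chiD.
  have [i wi] := rV0Pn _ w0; have [a ca] := chi_neq1.
  by exists ((a / w 0 i) *: delta_mx 0 i); rewrite dotvZl dotv_delta divfK.
rewrite (eq_bigr (fun=> 1)) => [|s _]; last by rewrite dotv0 chi0.
by rewrite sumr_const card_mx mul1n mulr1 natrX.
Qed.

Lemma chiX a n : chi (a *+ n) = chi a ^+ n.
Proof. by elim: n => [|n IH]; rewrite ?mulr0n // mulrS exprS chiD IH. Qed.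

(** With p the characteristic, p a = 0, so [chi a] is a p-th root of unity. *)
Lemma norm_chi a : `|chi a| = 1.
Proof.
have [p p_pr pF] := finPcharP F.
apply/eqP; rewrite -(@pexpr_eq1 _ _ p) ?prime_gt0 // -normrX -chiX.
by rewrite -mulr_natr pcharf0 // mulr0 chi0 normr1.
Qed.

Lemma chi_unit a : chi a != 0.
Proof. by rewrite -normr_eq0 norm_chi oner_eq0. Qed.

Lemma chiN a : chi (- a) = (chi a)^-1.
Proof. by apply: (mulfI (chi_unit a)); rewrite -chiD subrr chi0 divff ?chi_unit. Qed.

Lemma conj_chi a : (chi a)^* = chi (- a).
Proof. by rewrite chiN invC_norm norm_chi expr1n invr1 mul1r. Qed.

End Characters.

(** * Gauss sums *)

(** Listing F^* as powers of [g] turns multiplication by [g] into a shift of exponents; this does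
    the work of the quadratic character. *)
Lemma sum_neq0_prim_root (V : nmodType) (F : finFieldType) (g : F) (h : F -> V) :
  (#|F|.-1).-primitive_root g ->
  \sum_(t | t != 0) h t = \sum_(i < #|F|.-1) h (g ^+ i).
Proof.
move=> gP; pose e (i : 'I_#|F|.-1) := g ^+ i.
have q1 := finNzRing_gt1 F.
have e_inj : {in [set: 'I_#|F|.-1] &, injective e}.
  move=> i j _ _ /eqP; rewrite (eq_prim_root_expr gP) !modn_small // => /eqP.
  exact: val_inj.
have -> : \sum_(i < #|F|.-1) h (g ^+ i) = \sum_(i in [set: 'I_#|F|.-1]) h (e i).
  by apply: eq_bigl => i; rewrite inE.
rewrite -(big_imset _ e_inj); apply: eq_bigl => t; apply/idP/imsetP => [t0 | [i _ ->]].
  have tq : t ^+ #|F|.-1 = 1.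
    by apply: (mulfI t0); rewrite -exprS prednK ?expf_card ?mulr1 // ltnW.
  by have [i ->] := prim_rootP gP tq; exists i.
by rewrite expf_neq0 // (prim_root_eq0 gP) -lt0n -ltnS prednK // ltnW.
Qed.

Lemma sum_even_odd (V : nmodType) (a : nat -> V) n :
  \sum_(i < n) (a i.*2 + a i.*2.+1) = \sum_(i < n.*2) a i.
Proof.
by elim: n => [|n IH]; rewrite ?big_ord0 // doubleS !big_ord_recr /= IH addrA.
Qed.

Section GaussSums.
Variables (C : numClosedFieldType) (F : finFieldType) (chi : F -> C).
Hypotheses (chi0 : chi 0 = 1) (chiD : forall a b, chi (a + b) = chi a * chi b).
Hypothesis chi_neq1 : exists a, chi a != 1.
Hypothesis two_neq0 : 2 != 0 :> F.
Local Notation q := (#|F|%:R : C).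

Let four_neq0 : 4 != 0 :> F.
Proof. by rewrite (natrM _ 2 2) mulf_neq0. Qed.

Definition gauss_sum s := \sum_t chi (s * t ^+ 2).

(** With t = r + h, the phase s (t^2 - r^2) = s h^2 + 2 s r h is linear in r, so summing over r
    leaves only h = 0. *)
Lemma gauss_sum_mulN s : s != 0 -> gauss_sum s * gauss_sum (- s) = q.
Proof.
move=> s0; rewrite mulrC /gauss_sum mulr_suml.
transitivity (\sum_r \sum_h chi (s * h ^+ 2) * chi (r * (2 * s * h))).
  apply: eq_bigr => r _; rewrite mulr_sumr (reindex_inj (addrI r)) /=.
  by apply: eq_bigr => h _; rewrite -!chiD; congr chi; ring.
rewrite exchange_big /=.
under eq_bigr => h _ do rewrite -mulr_sumr sum_char // !mulf_eq0 (negPf s0) (negPf two_neq0) /=.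
rewrite (bigD1 0) //= eqxx expr0n mulr0 chi0 mulr1 mul1r big1 ?addr0 // => h h0.
by rewrite (negPf h0) !mulr0.
Qed.

Lemma conj_gauss_sum s : (gauss_sum s)^* = gauss_sum (- s).
Proof. by rewrite rmorph_sum; apply: eq_bigr => t _; rewrite /= conj_chi // mulNr. Qed.

Lemma norm_gauss_sum s : s != 0 -> `|gauss_sum s| ^+ 2 = q.
Proof. by move=> s0; rewrite normCK conj_gauss_sum gauss_sum_mulN. Qed.

Lemma gauss_sum_shift s w : s != 0 ->
  \sum_t chi (s * t ^+ 2 + t * w) = chi (- (w ^+ 2 / (4 * s))) * gauss_sum s.
Proof.
move=> s0; rewrite mulr_sumr (reindex_inj (addIr (- (w / (2 * s))))) /=.
apply: eq_bigr => t _; rewrite -chiD; congr chi.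
by field; rewrite s0 four_neq0 two_neq0.
Qed.

Lemma sum_char_dotv_sqr d s : \sum_(z : 'rV[F]_d) chi (s * dotv z z) = gauss_sum s ^+ d.
Proof.
rewrite -[in RHS](card_ord d) -prodr_const.
rewrite (bigA_distr_bigA (fun=> fun t => chi (s * t ^+ 2))) /=.
rewrite (reindex (fun f : {ffun 'I_d -> F} => \row_i f i)) /=; last first.
  exists (fun z : 'rV[F]_d => [ffun i => z 0 i]) => [f _|z _].
    by apply/ffunP => i; rewrite ffunE mxE.
  by apply/rowP => i; rewrite !mxE ffunE.
apply: eq_bigr => f _; rewrite /dotv mulr_sumr.
rewrite (big_morph chi chiD chi0); apply: eq_bigr => i _.
by rewrite mxE expr2.
Qed.

Lemma sum_char_dotv_shift d s (w : 'rV[F]_d) : s != 0 ->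
  \sum_z chi (s * dotv z z + dotv z w) =
    chi (- (dotv w w / (4 * s))) * gauss_sum s ^+ d.
Proof.
move=> s0; rewrite -sum_char_dotv_sqr mulr_sumr.
rewrite (reindex_inj (addIr (- ((2 * s)^-1 *: w)))) /=.
apply: eq_bigr => t _; rewrite -chiD; congr chi; rewrite !dotvE (dotvC w t).
by field; rewrite s0 four_neq0 two_neq0.
Qed.

Variable g : F.
Hypothesis g_prim : (#|F|.-1).-primitive_root g.

Lemma prim_root_neq0 : g != 0.
Proof.
by rewrite (prim_root_eq0 g_prim) -lt0n -ltnS prednK ?finNzRing_gt1 // ltnW ?finNzRing_gt1.
Qed.

(** At t = g^i the two sums carry the exponents 2i and 2i + 1 of [g]. Together these run through F^*
    twice, contributing -2, which cancels the two terms t = 0. *)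
Lemma gauss_sum_mul_prim_root s : s != 0 -> gauss_sum (g * s) = - gauss_sum s.
Proof.
move=> s0; apply/eqP; rewrite -addr_eq0 /gauss_sum.
rewrite (bigD1 0) //= [X in _ + _ + X](bigD1 0) //= !(sum_neq0_prim_root _ g_prim).
rewrite addrACA addrC -big_split /=.
under eq_bigr => i _ do
  rewrite -exprM muln2 (mulrC g) -mulrA -exprS addrC.
rewrite (sum_even_odd (fun i => chi (s * g ^+ i))) -addnn big_split_ord /=.
under [X in _ + X + _]eq_bigr => i _ do
  rewrite exprD (prim_expr_order g_prim) mul1r.
rewrite -!(sum_neq0_prim_root (fun t => chi (s * t)) g_prim).
under eq_bigr => i _ do rewrite mulrC.
by rewrite sum_char_neq0 // (negPf s0) expr0n !mulr0 chi0 sub0r addrACA addNr addr0.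
Qed.

(** [a] is a power of [g], and each factor [g] only changes the sign. *)
Lemma gauss_sum_sqr a s : a != 0 -> s != 0 -> gauss_sum (a * s) ^+ 2 = gauss_sum s ^+ 2.
Proof.
move=> a0 s0.
have aq : a ^+ #|F|.-1 = 1.
  by apply: (mulfI a0); rewrite -exprS prednK ?expf_card ?mulr1 // ltnW ?finNzRing_gt1.
have [[i /= _] ->] := prim_rootP g_prim aq.
elim: i => [|i IH]; first by rewrite mul1r.
rewrite (exprS g) -mulrA gauss_sum_mul_prim_root ?sqrrN //.
by rewrite mulf_neq0 ?expf_neq0 ?prim_root_neq0.
Qed.

Lemma gauss_sum_pow4 s : s != 0 -> gauss_sum s ^+ 4 = q ^+ 2.
Proof.
move=> s0; rewrite -(gauss_sum_mulN s0) exprMn -(mulN1r s) gauss_sum_sqr //; first by ring.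
by rewrite oppr_eq0 oner_eq0.
Qed.

(* The sign of this product of Gauss sums says that the quadratic form
   [x_1 ^ 2 + ... + x_d ^ 2 - g * t ^ 2] is elliptic. *)
Lemma gauss_sum_elliptic k s : s != 0 ->
  gauss_sum s ^+ (4 * k + 1) * gauss_sum (- (g * s)) = - q ^+ (2 * k + 1).
Proof.
move=> s0; rewrite -mulrN gauss_sum_mul_prim_root ?oppr_eq0 //.
rewrite exprD exprM gauss_sum_pow4 // -exprM expr1 mulrN -mulrA gauss_sum_mulN //.
by rewrite exprD expr1.
Qed.

(** A pair [Z] stands for a vector with d + 1 coordinates; for [a] on the sphere, [(a, 1)] lies on
    this cone. *)
Definition cone d : pred ('rV[F]_d * F) := fun Z => dotv Z.1 Z.1 == g * Z.2 ^+ 2.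

(** Membership in the cone is detected by a sum over s of chi (s (z.z - g t^2)). The term s = 0
    gives the point mass. For s != 0, completing squares leaves the product of [gauss_sum_elliptic],
    whose value is independent of s, times a character of 1/s. *)
Lemma sum_char_cone k (w : 'rV[F]_(4 * k + 1)) (w0 : F) :
  q * \sum_(Z | cone Z) chi (dotv Z.1 w + Z.2 * w0) =
  q ^+ (4 * k + 2) * ((w == 0) && (w0 == 0))%:R
  - q ^+ (2 * k + 1) * (q * (g * dotv w w == w0 ^+ 2)%:R - 1).
Proof.
have g0 := prim_root_neq0.
have four0 := four_neq0.
transitivity (\sum_s \sum_(z : 'rV[F]_(4 * k + 1)) \sum_t
    chi (s * dotv z z + dotv z w) * chi (- (g * s) * t ^+ 2 + t * w0)).
  rewrite exchange_big /=.
  under [RHS]eq_bigr => z _ do rewrite exchange_big /=.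
  rewrite pair_bigA /= mulr_sumr [LHS]big_mkcond /=.
  apply: eq_bigr => -[z t] _ /=.
  transitivity (\sum_s chi (s * (dotv z z - g * t ^+ 2)) * chi (dotv z w + t * w0)).
    rewrite -mulr_suml sum_char // subr_eq0 /cone /=.
    by case: eqP; rewrite ?mulr1 ?mulr0 ?mul0r.
  by apply: eq_bigr => s _; rewrite -!chiD; congr chi; ring.
rewrite (bigD1 0) //=; congr (_ + _).
  transitivity ((\sum_(z : 'rV[F]_(4 * k + 1)) chi (dotv z w)) * \sum_t chi (t * w0)).
    rewrite [RHS]mulr_suml; apply: eq_bigr => z _; rewrite [RHS]mulr_sumr.
    by apply: eq_bigr => t _; rewrite mulr0 oppr0 !mul0r !add0r.
  rewrite sum_char_dotv // sum_char // mulrACA -natrM mulnb -exprSr.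
  by rewrite -addnS.
transitivity (\sum_(s | s != 0) - q ^+ (2 * k + 1) *
    chi (s^-1 * ((w0 ^+ 2 - g * dotv w w) / (4 * g)))).
  apply: eq_bigr => s s0; rewrite -(gauss_sum_elliptic k s0).
  have gs0 : - (g * s) != 0 by rewrite oppr_eq0 mulf_neq0.
  under eq_bigr => z _ do rewrite -mulr_sumr gauss_sum_shift //.
  rewrite -mulr_suml sum_char_dotv_shift // mulrACA mulrC -chiD; congr (_ * chi _).
  by field; rewrite s0 g0 four0.
rewrite -mulr_sumr mulNr; congr (- (_ * _)).
(* Replacing s by its inverse makes the phase linear in s. *)
rewrite (reindex_inj (@invr_inj F)) /=.
under eq_big => [s|s _] do [rewrite invr_eq0 | rewrite invrK].
rewrite sum_char_neq0 // mulf_eq0 invr_eq0 mulf_eq0 (negPf four0) (negPf g0) !orbF.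
by rewrite subr_eq0 eq_sym.
Qed.

End GaussSums.

(** * Rectangles in the sphere, and orthogonality kernels *)

Section SphereGeometry.
Variables (F : finFieldType) (d : nat) (g : F).
Hypothesis two_neq0 : 2 != 0 :> F.
Implicit Types a b c : 'rV[F]_d.
Local Notation S := (sphere d g).

Lemma sphere_dotvB a c : a \in S -> c \in S ->
  dotv (a - c) (a - c) = - (2 * dotv (a - c) c).
Proof.
by rewrite !in_sphere => /eqP aS /eqP cS; rewrite !dotvE aS cS (dotvC c a); ring.
Qed.

(** [dotv a c != g] says that a - c is not isotropic; the line from [c] along it then meets the
    sphere in a single further point. Comparing the dot products with [c] and the norms of the two
    sides gives s = t. *)
Lemma sphere_lines_inj a b c s t : a \in S -> b \in S -> c \in S ->
  dotv a c != g -> dotv b c != g -> s != 0 -> s *: (a - c) = t *: (b - c) ->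
  a = b /\ s = t.
Proof.
move=> aS bS cS ac bc s0 eq_st.
have yE := sphere_dotvB aS cS; have zE := sphere_dotvB bS cS.
have ac0 : dotv (a - c) c != 0.
  by move: cS; rewrite dotvBl in_sphere subr_eq0 => /eqP ->.
have e1 := congr1 (fun y => dotv y c) eq_st.
have e2 := congr1 (fun y => dotv y y) eq_st.
rewrite /= !(dotvZl, dotvZr) yE zE in e1 e2.
have st : s = t.
  apply: (mulIf (mulf_neq0 (mulf_neq0 s0 ac0) two_neq0)).
  have -> : t * (s * dotv (a - c) c * 2) = - (t * (t * - (2 * dotv (b - c) c))).
    by rewrite e1; ring.
  by rewrite -e2; ring.
split=> //; move: eq_st; rewrite -st => /(scalerI s0) /addIr.
exact.
Qed.

(** The norm of a + b - c exceeds [g] by 2 (a - c).(b - c): parallelograms inscribed in the sphere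
    are rectangles. *)
Lemma rectangle_fourth a b c : a \in S -> b \in S -> c \in S ->
  (a + b - c \in S) = (dotv (a - c) (b - c) == 0).
Proof.
rewrite !in_sphere => /eqP aS /eqP bS /eqP cS.
rewrite -subr_eq0 !dotvE aS bS cS (dotvC c b) (dotvC c a) (dotvC b a).
rewrite [X in X == 0](_ : _ = 2 * (dotv a b - dotv a c + (- dotv b c - - g))) //; last by ring.
by rewrite mulf_eq0 (negPf two_neq0).
Qed.

(** Opposite sides have equal norm, which on the sphere determines the dot product of their ends.
    Isotropy of a side thus survives the symmetries of the rectangle. *)
Lemma rectangle_side a b c : a \in S -> b \in S -> c \in S ->
  a + b - c \in S -> dotv b (a + b - c) = dotv a c.
Proof.
move=> aS bS cS; rewrite rectangle_fourth //.
move: aS bS cS; rewrite !in_sphere => /eqP aS /eqP bS /eqP cS /eqP.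
rewrite !dotvE bS cS (dotvC c b) (dotvC b a) => e.
by apply/eqP; rewrite -subr_eq0 -e; apply/eqP; ring.
Qed.

End SphereGeometry.

Lemma sum_neq0_const (R : pzRingType) (F : finFieldType) (c : R) :
  \sum_(s : F | s != 0) c = (#|F|%:R - 1) * c.
Proof.
rewrite mulrBl mul1r mulr_natl -sumr_const [in RHS](bigD1 (0 : F)) //=.
by rewrite addrC addrK.
Qed.

(** * Correlations of balanced hyperplane indicators, and the size of the sphere *)

Section Kernels.
Variables (C : numClosedFieldType) (F : finFieldType) (chi : F -> C).
Hypotheses (chi0 : chi 0 = 1) (chiD : forall a b, chi (a + b) = chi a * chi b).
Hypothesis chi_neq1 : exists a, chi a != 1.
Hypothesis two_neq0 : 2 != 0 :> F.
Variable g : F.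
Hypothesis g_prim : (#|F|.-1).-primitive_root g.
Local Notation q := (#|F|%:R : C).

Lemma sum_neq0_pred1 (x : C) (c : F) :
  c != 0 -> \sum_(s | s != 0) x * (s == c)%:R = x.
Proof.
move=> c0; rewrite (bigD1 c) //= eqxx big1 ?addr0 ?mulr1 // => s /andP[_ /negPf ->].
by rewrite mulr0.
Qed.

(** The factor of [a] is the balanced indicator of the hyperplane orthogonal to [(a, 1)], a sum of
    characters over s != 0. Then [sum_char_cone] applies with w = s a + t b and w0 = - g (s + t):
    both vanish only if a = b and t = - s, and g w.w - w0^2 = 2 g s t (a.b - g). *)
Lemma cone_kernel k (a b : 'rV[F]_(4 * k + 1)) :
  a \in sphere _ g -> b \in sphere _ g ->
  \sum_(Z | cone g Z) (q * (dotv Z.1 a == g * Z.2)%:R - 1) *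
     (q * (dotv Z.1 b == g * Z.2)%:R - 1) =
  (q - 1) * q ^+ (4 * k + 1) * (a == b)%:R
  - (q - 1) ^+ 2 * q ^+ (2 * k) * (q * (dotv a b == g)%:R - 1).
Proof.
move=> aS bS; have g0 := prim_root_neq0 g_prim.
have q0 : q != 0 by rewrite pnatr_eq0 -lt0n (ltn_trans _ (finNzRing_gt1 F)).
apply: (mulfI q0).
transitivity (q * \sum_(Z | cone g Z) \sum_(s | s != 0) \sum_(t | t != 0)
    chi (dotv Z.1 (s *: a + t *: b) + Z.2 * (- (g * (s + t))))).
  congr (_ * _); apply: eq_bigr => -[z x] _ /=.
  rewrite -(subr_eq0 (dotv z a)) -(subr_eq0 (dotv z b)).
  rewrite -!(sum_char_neq0 chi0 chiD chi_neq1) mulr_suml.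
  apply: eq_bigr => s _; rewrite mulr_sumr; apply: eq_bigr => t _.
  by rewrite -chiD !dotvE; congr chi; ring.
rewrite exchange_big /=.
under eq_bigr => s _ do rewrite exchange_big /=.
rewrite mulr_sumr.
transitivity (\sum_(s : F | s != 0) (q ^+ (4 * k + 2) * (a == b)%:R
    - (q - 1) * (q ^+ (2 * k + 1) * (q * (dotv a b == g)%:R - 1)))).
  apply: eq_bigr => s s0; rewrite mulr_sumr -sum_neq0_const.
  have Ns0 : - s != 0 by rewrite oppr_eq0.
  rewrite -(sum_neq0_pred1 (_ * (a == b)%:R) Ns0) -sumrB.
  apply: eq_bigr => t t0; rewrite (sum_char_cone chi0 chiD chi_neq1 two_neq0 g_prim).
  congr (_ - _ * (_ * _%:R - _)).
    rewrite -mulrA -natrM mulnb oppr_eq0 mulf_eq0 (negPf g0) /= addr_eq0.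
    rewrite andbC [in RHS]andbC (addrC s t) addr_eq0.
    have [-> | //] := eqVneq t (- s).
    by rewrite scaleNr opprK (inj_eq (scalerI s0)).
  congr nat_of_bool; rewrite sqrrN !dotvE (dotvC b a) -subr_eq0.
  move: aS bS; rewrite !in_sphere => /eqP -> /eqP ->.
  rewrite [X in X == 0](_ : _ = (2 * g * s * t) * (dotv a b - g)); last by ring.
  by rewrite mulf_eq0 !mulf_eq0 (negPf two_neq0) (negPf g0) (negPf s0) (negPf t0) subr_eq0.
have -> : q ^+ (4 * k + 2) = q * q ^+ (4 * k + 1) by rewrite -exprS -addnS.
have -> : q ^+ (2 * k + 1) = q * q ^+ (2 * k) by rewrite -exprS addn1.
rewrite sum_neq0_const.
by ring.
Qed.

(** Expanding in characters, only s y + t z = 0 survives, which the hypothesis restricts to y = z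
    and t = - s. *)
Lemma line_kernel d (y z : 'rV[F]_d) :
  (forall s t, s != 0 -> s *: y = t *: z -> y = z /\ s = t) ->
  \sum_x (q * (dotv x y == 0)%:R - 1) * (q * (dotv x z == 0)%:R - 1) =
  (q - 1) * q ^+ d * (y == z)%:R.
Proof.
move=> yz.
transitivity (\sum_x \sum_(s | s != 0) \sum_(t | t != 0)
    chi (dotv x (s *: y + t *: z))).
  apply: eq_bigr => x _; rewrite -!(sum_char_neq0 chi0 chiD chi_neq1) mulr_suml.
  apply: eq_bigr => s _; rewrite mulr_sumr; apply: eq_bigr => t _.
  by rewrite -chiD !dotvE.
rewrite exchange_big /=.
under eq_bigr => s _ do rewrite exchange_big /=.
rewrite -mulrA -sum_neq0_const; apply: eq_bigr => s s0.
have Ns0 : - s != 0 by rewrite oppr_eq0.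
rewrite -[RHS](sum_neq0_pred1 _ Ns0).
apply: eq_bigr => t t0; rewrite (sum_char_dotv chi0 chiD chi_neq1) -mulrA -natrM mulnb.
congr (_ * _%:R); congr nat_of_bool; rewrite addr_eq0 -scaleNr.
apply/eqP/andP => [/(yz s _ s0)[-> ->]|[/eqP -> /eqP ->]]; last by rewrite opprK.
by rewrite opprK !eqxx.
Qed.

Lemma card_sphere_sum d :
  q * #|sphere d g|%:R = q ^+ d + \sum_(s | s != 0) chi (- (s * g)) * gauss_sum chi s ^+ d.
Proof.
transitivity (\sum_(z : 'rV[F]_d) \sum_s chi (s * (dotv z z - g))).
  rewrite -sum1_card natr_sum mulr_sumr big_mkcond /=; apply: eq_bigr => z _.
  rewrite (sum_char chi0 chiD chi_neq1) subr_eq0 in_sphere.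
  by case: eqP => //; rewrite mulr0.
rewrite exchange_big (bigD1 0) //=; congr (_ + _).
  rewrite (eq_bigr (fun=> 1)) => [|z _]; last by rewrite mul0r chi0.
  by rewrite sumr_const card_mx mul1n natrX.
apply: eq_bigr => s _; rewrite -(sum_char_dotv_sqr chi0 chiD) mulr_sumr.
by apply: eq_bigr => z _; rewrite -chiD mulrBr addrC.
Qed.

(** Each term of the sum in [card_sphere_sum] has modulus q^(d/2); squaring avoids half-integer
    powers. *)
Lemma norm_card_sphere_sub d :
  `|q * #|sphere d g|%:R - q ^+ d| ^+ 2 <= q ^+ (d + 2).
Proof.
rewrite card_sphere_sum addrC addKr.
have [s0 s00] : exists s : F, s != 0 by exists 1; rewrite oner_eq0.
have gaussE s : s != 0 -> `|gauss_sum chi s| = `|gauss_sum chi s0|.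
  move=> sn0; apply/eqP; rewrite -(@eqrXn2 _ 2) //.
  by rewrite !(norm_gauss_sum chi0 chiD chi_neq1 two_neq0).
have le1 : `|\sum_(s | s != 0) chi (- (s * g)) * gauss_sum chi s ^+ d|
    <= q * `|gauss_sum chi s0| ^+ d.
  apply: (le_trans (ler_norm_sum _ _ _)).
  rewrite (eq_bigr (fun=> `|gauss_sum chi s0| ^+ d)) => [|s sn0]; last first.
    by rewrite normrM normrX (norm_chi chi0 chiD) mul1r gaussE.
  by rewrite sum_neq0_const ler_wpM2r ?exprn_ge0 // gerBl.
apply: (le_trans (lerXn2r 2 _ _ le1)); rewrite ?nnegrE ?mulr_ge0 ?exprn_ge0 //.
rewrite exprMn -exprM mulnC exprM (norm_gauss_sum chi0 chiD chi_neq1 two_neq0) //.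
by rewrite -exprD addnC.
Qed.

End Kernels.

(** * Counting orthogonal pairs *)

Lemma sum_sqr_kernel (R : comPzRingType) (I J : finType) (P : pred I) (Q : pred J)
    (u : J -> R) (L : J -> I -> R) :
  \sum_(i | P i) (\sum_(j | Q j) u j * L j i) ^+ 2 =
  \sum_(j | Q j) \sum_(j' | Q j') u j * u j' * \sum_(i | P i) L j i * L j' i.
Proof.
under eq_bigr => i _.
  rewrite expr2 mulr_suml.
  under eq_bigr => j _ do rewrite mulr_sumr.
  over.
rewrite exchange_big /=; apply: eq_bigr => j _.
rewrite exchange_big /=; apply: eq_bigr => j' _.
by rewrite mulr_sumr; apply: eq_bigr => i _; rewrite mulrACA.
Qed.

Lemma sum_diagonal (R : comPzRingType) (J : finType) (Q : pred J) (u : J -> R) :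
  \sum_(j | Q j) \sum_(j' | Q j') u j * u j' * (j == j')%:R =
  \sum_(j | Q j) u j ^+ 2.
Proof.
apply: eq_bigr => j Qj; rewrite (bigD1 j) //= eqxx mulr1 expr2 big1 ?addr0 //.
by move=> j' /andP[_]; rewrite eq_sym => /negPf ->; rewrite mulr0.
Qed.

Lemma sum_sqr_product (R : comPzRingType) (J : finType) (Q : pred J) (u : J -> R) :
  \sum_(j | Q j) \sum_(j' | Q j') u j * u j' = (\sum_(j | Q j) u j) ^+ 2.
Proof. by rewrite expr2 mulr_suml; apply: eq_bigr => j _; rewrite mulr_sumr. Qed.

Section RealKernels.
Variables (R : realType) (F : finFieldType) (chi : F -> R[i]).
Hypotheses (chi0 : chi 0 = 1) (chiD : forall a b, chi (a + b) = chi a * chi b).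
Hypothesis chi_neq1 : exists a, chi a != 1.
Hypothesis two_neq0 : 2 != 0 :> F.
Variable g : F.
Hypothesis g_prim : (#|F|.-1).-primitive_root g.
Local Notation q := (#|F|%:R : R).
Local Notation r := (Num.sqrt q).

Let q_gt1 : 1 < q. Proof. exact: card_finField_natr_gt1. Qed.
Let q_gt0 : 0 < q. Proof. by rewrite (lt_trans _ q_gt1). Qed.
Let r_sqr : r ^+ 2 = q. Proof. by rewrite sqr_sqrtr // ltW. Qed.
Let r_gt0 : 0 < r. Proof. by rewrite sqrtr_gt0. Qed.

Lemma cone_kernel_real k (a b : 'rV[F]_(4 * k + 1)) :
  a \in sphere _ g -> b \in sphere _ g ->
  \sum_(Z | cone g Z) (q * (dotv Z.1 a == g * Z.2)%:R - 1) *
     (q * (dotv Z.1 b == g * Z.2)%:R - 1) =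
  (q - 1) * q ^+ (4 * k + 1) * (a == b)%:R
  - (q - 1) ^+ 2 * q ^+ (2 * k) * (q * (dotv a b == g)%:R - 1).
Proof.
move=> aS bS; apply: (@complexI R).
have := cone_kernel chi0 chiD chi_neq1 two_neq0 g_prim aS bS.
rewrite rmorph_sum /= !(rmorphB, rmorphM, rmorphXn, rmorph_nat, rmorph1) => <-.
by apply: eq_bigr => Z _; rewrite !(rmorphB, rmorphM, rmorphXn, rmorph_nat, rmorph1).
Qed.

Lemma line_kernel_real d (y z : 'rV[F]_d) :
  (forall s t, s != 0 -> s *: y = t *: z -> y = z /\ s = t) ->
  \sum_x (q * (dotv x y == 0)%:R - 1) * (q * (dotv x z == 0)%:R - 1) =
  (q - 1) * q ^+ d * (y == z)%:R.
Proof.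
move=> yz; apply: (@complexI R).
have := line_kernel chi0 chiD chi_neq1 yz.
rewrite rmorph_sum /= !(rmorphB, rmorphM, rmorphXn, rmorph_nat, rmorph1) => <-.
by apply: eq_bigr => Z _; rewrite !(rmorphB, rmorphM, rmorphXn, rmorph_nat, rmorph1).
Qed.

(** A sum of squares over the cone is nonnegative. By [cone_kernel_real] it is a positive multiple
    of q^(2k+1) N - (q - 1) (q T - U^2), where [T] has a negative coefficient and so is bounded
    above. *)
Lemma isotropic_pairs k (u : 'rV[F]_(4 * k + 1) -> R) : (0 < k)%N ->
  \sum_(a in sphere _ g) \sum_(b in sphere _ g) u a * u b * (dotv a b == g)%:R <=
  (\sum_(a in sphere _ g) u a) ^+ 2 / q
  + 2 * r ^+ (4 * k - 1) * \sum_(a in sphere _ g) u a ^+ 2.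
Proof.
move=> k0.
pose L (a : 'rV[F]_(4 * k + 1)) Z := q * (dotv Z.1 a == g * Z.2)%:R - 1.
set T := \sum_(a in _) _; set U := \sum_(a in _) u a; set N := \sum_(a in _) u a ^+ 2.
have N0 : 0 <= N by apply: sumr_ge0 => a _; rewrite sqr_ge0.
have : 0 <= \sum_(Z | cone g Z) (\sum_(a in sphere (4 * k + 1) g) u a * L a Z) ^+ 2.
  by apply: sumr_ge0 => Z _; rewrite sqr_ge0.
rewrite sum_sqr_kernel.
have -> : \sum_(a in sphere (4 * k + 1) g) \sum_(b in sphere (4 * k + 1) g)
    u a * u b * (\sum_(Z | cone g Z) L a Z * L b Z) =
    (q - 1) * q ^+ (4 * k + 1) * N - (q - 1) ^+ 2 * q ^+ (2 * k) * (q * T - U ^+ 2).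
  rewrite /N /T /U -sum_diagonal -sum_sqr_product !mulr_sumr -sumrB mulr_sumr -sumrB.
  apply: eq_bigr => a aS; rewrite !mulr_sumr -sumrB mulr_sumr -sumrB.
  by apply: eq_bigr => b bS; rewrite cone_kernel_real //; ring.
have q21 : 0 < (q - 1) * q ^+ (2 * k) by rewrite mulr_gt0 ?exprn_gt0 // subr_gt0.
have -> : q ^+ (4 * k + 1) = q ^+ (2 * k) * (q ^+ (2 * k) * q).
  by rewrite -exprSr -exprD; congr (_ ^+ _); lia.
have -> : (q - 1) * (q ^+ (2 * k) * (q ^+ (2 * k) * q)) * N -
    (q - 1) ^+ 2 * q ^+ (2 * k) * (q * T - U ^+ 2) =
    (q - 1) * q ^+ (2 * k) * (q ^+ (2 * k) * q * N - (q - 1) * (q * T - U ^+ 2)) by ring.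
rewrite pmulr_rge0 // subr_ge0 => le1.
have qE : q ^+ (2 * k) = r ^+ (4 * k - 1) * r.
  by rewrite -exprSr -[in LHS]r_sqr -exprM; congr (_ ^+ _); lia.
rewrite qE in le1; rewrite -(ler_pM2l q_gt0) mulrDr mulrCA divff ?gt_eqF // mulr1.
rewrite -lerBlDl -(@ler_pM2l _ (q - 1)) ?subr_gt0 //; apply: (le_trans le1).
have q2 : 2 <= q by rewrite ler_nat finNzRing_gt1.
(* This weakens the coefficient of [N] from about r^(4k-2) to r^(4k-1), the size that
   [anisotropic_pairs] gives anyway. *)
have rle : r <= 2 * (q - 1) by have r2 := r_sqr; nra.
have rN : 0 <= r ^+ (4 * k - 1) * q * N by rewrite !mulr_ge0 ?exprn_ge0 // ltW.
have -> : r ^+ (4 * k - 1) * r * q * N = r * (r ^+ (4 * k - 1) * q * N) by ring.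
have -> : (q - 1) * (q * (2 * r ^+ (4 * k - 1) * N)) =
  2 * (q - 1) * (r ^+ (4 * k - 1) * q * N) by ring.
exact: ler_wpM2r.
Qed.

(** q T - U^2 pairs [u] with the values h (a - c). The sum of h^2 over the whole space is known from
    [line_kernel_real]; [h] is constant on punctured lines and the a - c span distinct lines, so
    their values take at most a fraction 1/(q - 1) of that sum. *)
Lemma anisotropic_pairs d (c : 'rV[F]_d) (u : 'rV[F]_d -> R) :
  (2 <= d)%N -> c \in sphere d g ->
  \sum_(a in sphere d g | dotv a c != g) \sum_(b in sphere d g | dotv b c != g)
    u a * u b * (dotv (a - c) (b - c) == 0)%:R <=
  (\sum_(a in sphere d g | dotv a c != g) u a) ^+ 2 / q
  + r ^+ (d - 2) * \sum_(a in sphere d g | dotv a c != g) u a ^+ 2.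
Proof.
move=> d2 cS; pose Q := [pred a | (a \in sphere d g) && (dotv a c != g)].
have linesI a b s t : Q a -> Q b -> s != 0 -> s *: (a - c) = t *: (b - c) -> a = b /\ s = t.
  by move=> /andP[aS ac] /andP[bS bc]; apply: (sphere_lines_inj two_neq0 aS bS cS).
pose L a x := q * (dotv x (a - c) == 0)%:R - 1.
pose h x := \sum_(b | Q b) u b * L b x.
rewrite -/(Q _); set T := \sum_(a | _) _; set U := \sum_(a | _) u a; set N := \sum_(a | _) u a ^+ 2.
have hS : \sum_x h x ^+ 2 = (q - 1) * q ^+ d * N.
  rewrite sum_sqr_kernel /N -sum_diagonal mulr_sumr; apply: eq_bigr => a Qa.
  rewrite mulr_sumr; apply: eq_bigr => b Qb.
  rewrite line_kernel_real => [|s t s0 st]; last by have [-> ->] := linesI _ _ _ _ Qa Qb s0 st.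
  by rewrite (inj_eq (addIr _)) mulrCA mulrA.
have hZ s x : s != 0 -> h (s *: x) = h x.
  by move=> s0; apply: eq_bigr => b _; rewrite /L dotvZl mulf_eq0 (negPf s0).
(* The factor q - 1 counts each value once for every s != 0; the points s (a - c) are pairwise
   distinct, so the full sum dominates. *)
have hL : \sum_(a | Q a) h (a - c) ^+ 2 <= q ^+ d * N.
  have q10 : 0 < q - 1 by rewrite subr_gt0.
  rewrite -(ler_pM2l q10) mulrA -hS -sum_neq0_const.
  under eq_bigr => s s0.
    under eq_bigr => a _ do rewrite -(hZ s) //.
    over.
  rewrite pair_big /=.
  pose e (p : F * 'rV[F]_d) := p.1 *: (p.2 - c).
  pose D := [set p : F * 'rV[F]_d | (p.1 != 0) && Q p.2].
  have DE p : (p \in D) = (p.1 != 0) && Q p.2 by rewrite in_set.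
  have e_inj : {in D &, injective e}.
    move=> [s a] [t b]; rewrite !DE => /andP[s0 Qa] /andP[t0 Qb] /(linesI _ _ _ _ Qa Qb s0).
    by case=> /= -> ->.
  rewrite (eq_bigl (mem D)) => [|p]; last by rewrite -DE.
  rewrite -(big_imset (fun x => h x ^+ 2) e_inj) /= [leRHS](bigID (mem (e @: D))) /=.
  by rewrite lerDl; apply: sumr_ge0 => x _; rewrite sqr_ge0.
have hT : q * T - U ^+ 2 = \sum_(a | Q a) u a * h (a - c).
  rewrite /T /U -sum_sqr_product mulr_sumr -sumrB; apply: eq_bigr => a _.
  rewrite !mulr_sumr -sumrB; apply: eq_bigr => b _; rewrite /L; ring.
have rd : r ^+ d = q * r ^+ (d - 2) by rewrite -{2}r_sqr -exprD subnKC.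
have rd0 : 0 < r ^+ d by rewrite exprn_gt0.
(* AM-GM: [2 r^d u h <= (r^d u)^2 + h^2] *)
have : q * T - U ^+ 2 <= r ^+ d * N.
  rewrite hT -(ler_pM2l rd0) -(@ler_pM2l _ 2) //.
  apply: (@le_trans _ _ (r ^+ d * r ^+ d * N + \sum_(a | Q a) h (a - c) ^+ 2)).
    rewrite !mulr_sumr -big_split /=; apply: ler_sum => a _.
    by have := sqr_ge0 (r ^+ d * u a - h (a - c)); nra.
  have -> : 2 * (r ^+ d * (r ^+ d * N)) = r ^+ d * r ^+ d * N + r ^+ d * r ^+ d * N by ring.
  by rewrite lerD2l -expr2 -exprM mulnC exprM r_sqr.
rewrite rd lerBlDl -mulrA => le1.
by rewrite -(ler_pM2l q_gt0) mulrDr mulrCA divff ?gt_eqF // mulr1.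
Qed.

(** Otherwise q |S| would differ from q^d by more than q^d / 2, against [norm_card_sphere_sub],
    since q^(4k-1) >= 2^3 > 4. *)
Lemma card_sphere_ge k : (0 < k)%N ->
  q ^+ (4 * k) <= 2 * #|sphere (4 * k + 1) g|%:R.
Proof.
move=> k0; set n := #|sphere _ _|.
have le1 : (q * n%:R - q ^+ (4 * k + 1)) ^+ 2 <= q ^+ (4 * k + 1 + 2).
  have := norm_card_sphere_sub chi0 chiD chi_neq1 two_neq0 g (4 * k + 1).
  rewrite real_normK ?rpredB ?rpredM ?rpredX ?realn // -lecR.
  by rewrite !(rmorphB, rmorphM, rmorphXn, rmorph_nat).
rewrite leNgt; apply/negP => lt_n.
have n0 : 0 <= n%:R :> R by [].
have q2 : 2 <= q by rewrite ler_nat finNzRing_gt1.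
set X := q ^+ (4 * k) in lt_n.
have X0 : 0 < X by rewrite exprn_gt0.
have XX : X * X * q ^+ 2 = q ^+ (4 * k + 1 + 2) * q ^+ (4 * k - 1).
  by rewrite -!exprD; congr (_ ^+ _); lia.
have Xq : 4 < q ^+ (4 * k - 1).
  have -> : (4 * k - 1 = 3 + (4 * k - 4))%N by lia.
  rewrite exprD; have : 1 <= q ^+ (4 * k - 4) by rewrite exprn_ege1 // ltW.
  have q8 : 8 <= q ^+ 3 by rewrite !exprS expr0; nra.
  by nra.
have Xp : 0 < q ^+ (4 * k + 1 + 2) by rewrite exprn_gt0.
have : 4 * q ^+ (4 * k + 1 + 2) < X * X * q ^+ 2 by rewrite XX mulrC ltr_pM2l.
have : X * X * q ^+ 2 <= 4 * (q * n%:R - q ^+ (4 * k + 1)) ^+ 2.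
  have -> : q ^+ (4 * k + 1) = X * q by rewrite -exprSr addn1.
  have -> : 4 * (q * n%:R - X * q) ^+ 2 = (4 * (X - n%:R) ^+ 2) * q ^+ 2 by ring.
  by rewrite ler_wpM2r ?sqr_ge0 //; nra.
by lra.
Qed.

End RealKernels.

(** * The number of rectangles *)

(** Two-variable AM-GM, applied within each pair and then to the two pair sums. *)
Lemma AGM4 (R : realDomainType) (x1 x2 x3 x4 y : R) :
  0 <= x1 -> 0 <= x2 -> 0 <= x3 -> 0 <= x4 -> x1 * x2 * (x3 * x4) = y ^+ 4 ->
  4 * y <= x1 + x2 + (x3 + x4).
Proof.
move=> x10 x20 x30 x40 xy.
have [y0 | y0] := ltP y 0; first by lra.
have le1 : 4 * (x1 * x2) <= (x1 + x2) ^+ 2 by have := sqr_ge0 (x1 - x2); nra.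
have le2 : 4 * (x3 * x4) <= (x3 + x4) ^+ 2 by have := sqr_ge0 (x3 - x4); nra.
have le3 : 4 * y ^+ 2 <= (x1 + x2) * (x3 + x4).
  rewrite -(@ler_pXn2r _ 2) ?nnegrE ?mulr_ge0 ?addr_ge0 ?sqr_ge0 //.
  rewrite [leRHS]exprMn [leLHS](_ : _ = (4 * (x1 * x2)) * (4 * (x3 * x4))).
    by apply: ler_pM; rewrite ?mulr_ge0.
  by rewrite [RHS]mulrACA xy; ring.
rewrite -(@ler_pXn2r _ 2) ?nnegrE ?mulr_ge0 ?addr_ge0 //.
by have := sqr_ge0 (x1 + x2 - (x3 + x4)); nra.
Qed.

Lemma ler_sum_subpred (R : numDomainType) (I : finType) (P Q : pred I) (h : I -> R) :
  (forall i, P i -> Q i) -> (forall i, 0 <= h i) ->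
  \sum_(i | P i) h i <= \sum_(i | Q i) h i.
Proof.
move=> PQ h0; rewrite [leRHS](bigID P) /=.
rewrite (eq_bigl (fun i => Q i && P i)) => [|i]; first by rewrite lerDl sumr_ge0.
by apply/idP/andP => [Pi|[]//]; split; first exact: PQ.
Qed.

Lemma sum_triple (R : comPzRingType) (I : finType) (P1 P2 P3 : pred I) (h1 h2 h3 : I -> R) :
  \sum_(t : I * I * I | [&& P1 t.1.1, P2 t.1.2 & P3 t.2]) h1 t.1.1 * h2 t.1.2 * h3 t.2 =
  (\sum_(i | P1 i) h1 i) * (\sum_(i | P2 i) h2 i) * (\sum_(i | P3 i) h3 i).
Proof.
rewrite [X in X * _]mulr_suml; under [X in X * _]eq_bigr => i _ do rewrite mulr_sumr.
rewrite pair_big /= mulr_suml.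
under [RHS]eq_bigr => p _ do rewrite mulr_sumr.
by rewrite pair_big /=; apply: eq_bigl => t; rewrite andbA.
Qed.

Section Rectangles.
Variables (R : realDomainType) (V : finZmodType) (phi : V -> R).
Implicit Type t : V * V * V.

(* [t = (a, b, c)] encodes the parallelogram with diagonals [{a, b}] and
   [{c, a + b - c}]; [flip] and [turn] generate the Klein group of symmetries
   swapping the ends of both diagonals, respectively the two diagonals. *)
Definition fourth t := t.1.1 + t.1.2 - t.2.
Definition flip t := (t.1.2, t.1.1, fourth t).
Definition turn t := (t.2, fourth t, t.1.1).
Definition quad t := phi t.1.1 * phi t.1.2 * phi t.2 * phi (fourth t).

Lemma fourth_flip t : fourth (flip t) = t.2.
Proof. by rewrite /fourth /= (addrC t.1.2) subKr. Qed.

Lemma fourth_turn t : fourth (turn t) = t.1.2.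
Proof. by rewrite /fourth /= addrC [t.2 + _]addrC subrK addKr. Qed.

Lemma flipK : involutive flip.
Proof. by move=> t; rewrite {1}/flip fourth_flip; case: t => [[]]. Qed.

Lemma turnK : involutive turn.
Proof. by move=> t; rewrite {1}/turn fourth_turn; case: t => [[]]. Qed.

(** AM-GM bounds [quad] by the average of [W] over the Klein group; the symmetries permute [Q], so
    the four resulting sums agree. *)
Lemma quad_AGM (Q : pred (V * V * V)) (W : V * V * V -> R) :
  (forall t, Q t -> Q (flip t)) -> (forall t, Q t -> Q (turn t)) ->
  (forall t, 0 <= W t) ->
  (forall t, W t * W (flip t) * (W (turn t) * W (flip (turn t))) = quad t ^+ 4) ->
  \sum_(t | Q t) quad t <= \sum_(t | Q t) W t.
Proof.
move=> Qflip Qturn W0 WE.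
have Qf t : Q (flip t) = Q t by apply/idP/idP => /Qflip; rewrite ?flipK.
have Qt t : Q (turn t) = Q t by apply/idP/idP => /Qturn; rewrite ?turnK.
have reflip (X : V * V * V -> R) : \sum_(t | Q t) X (flip t) = \sum_(t | Q t) X t.
  rewrite [RHS](reindex_inj (inv_inj flipK)).
  by apply: eq_bigl => t; rewrite Qf.
have returns (X : V * V * V -> R) : \sum_(t | Q t) X (turn t) = \sum_(t | Q t) X t.
  rewrite [RHS](reindex_inj (inv_inj turnK)).
  by apply: eq_bigl => t; rewrite Qt.
have : \sum_(t | Q t) 4 * quad t <=
    \sum_(t | Q t) (W t + W (flip t) + (W (turn t) + W (flip (turn t)))).
  by apply: ler_sum => t _; apply: AGM4.
rewrite -mulr_sumr !big_split /= reflip returns.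
rewrite (returns (fun t => W (flip t))) reflip; lra.
Qed.

End Rectangles.

(** * Weighted sums over rectangles *)

Section Energy.
Variables (R : realType) (F : finFieldType).
Hypothesis two_neq0 : 2 != 0 :> F.
Variables (g : F) (d : nat).
Local Notation V := 'rV[F]_d.
Local Notation S := (sphere d g).
Variables (phi u v : V -> R).
Hypotheses (u_ge0 : forall a, 0 <= u a) (v_ge0 : forall a, 0 <= v a).
Hypothesis uv : forall a, u a ^+ 2 * v a = phi a ^+ 4.

Definition rect : pred (V * V * V) :=
  fun t => [&& t.1.1 \in S, t.1.2 \in S, t.2 \in S & fourth t \in S].

Lemma rect_flip t : rect t -> rect (flip t).
Proof. by case/and4P=> *; rewrite /rect fourth_flip; apply/and4P. Qed.

Lemma rect_turn t : rect t -> rect (turn t).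
Proof. by case/and4P=> *; rewrite /rect fourth_turn; apply/and4P. Qed.

(** For either weight, the four symmetries give each vertex [u] twice and [v] once, as [quad_AGM]
    requires. *)
Let uuv (t : V * V * V) := u t.1.1 * u t.1.2 * v t.2.
Let uvu (t : V * V * V) := u t.1.1 * v t.1.2 * u t.2.

Let uuv_ge0 t : 0 <= uuv t. Proof. by rewrite !mulr_ge0. Qed.
Let uvu_ge0 t : 0 <= uvu t. Proof. by rewrite !mulr_ge0. Qed.

Let quad4 t : quad phi t ^+ 4 =
  (u t.1.1 ^+ 2 * v t.1.1) * (u t.1.2 ^+ 2 * v t.1.2) * (u t.2 ^+ 2 * v t.2) *
  (u (fourth t) ^+ 2 * v (fourth t)).
Proof. by rewrite !uv -!exprMn. Qed.

Let uuv_AGM t :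
  uuv t * uuv (flip t) * (uuv (turn t) * uuv (flip (turn t))) = quad phi t ^+ 4.
Proof. by rewrite quad4 /uuv /= fourth_turn; ring. Qed.

Let uvu_AGM t :
  uvu t * uvu (flip t) * (uvu (turn t) * uvu (flip (turn t))) = quad phi t ^+ 4.
Proof. by rewrite quad4 /uvu /= fourth_turn; ring. Qed.

Lemma energy_trivial :
  \sum_(t | rect t) quad phi t <= (\sum_(a in S) u a) ^+ 2 * \sum_(a in S) v a.
Proof.
apply: (le_trans (quad_AGM rect_flip rect_turn uuv_ge0 uuv_AGM)).
rewrite expr2 -(sum_triple (mem S) (mem S) (mem S) u u v).
by apply: ler_sum_subpred => // t /and4P[? ? ? _]; apply/and3P.
Qed.

Let flip_side t : rect t -> dotv t.1.2 (fourth t) = dotv t.1.1 t.2.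
Proof. by case/and4P=> aS bS cS eS; exact: (rectangle_side two_neq0 aS bS cS eS). Qed.

Let turn_side t : rect t -> dotv t.1.1 (fourth t) = dotv t.1.2 t.2.
Proof.
case/and4P=> aS bS cS; rewrite /fourth (addrC t.1.1) => eS.
exact: (rectangle_side two_neq0 bS aS cS eS).
Qed.

(** The weight [uvu] puts [u] on the ends of the isotropic side; forgetting the fourth vertex frees
    the vertex carrying [v]. *)
Lemma energy_isotropic :
  \sum_(t | rect t && (dotv t.1.1 t.2 == g)) quad phi t <=
  (\sum_(a in S) \sum_(b in S) u a * u b * (dotv a b == g)%:R) * \sum_(a in S) v a.
Proof.
apply: (le_trans (quad_AGM _ _ uvu_ge0 uvu_AGM)).
- by move=> t /andP[rt ac]; rewrite rect_flip //= flip_side.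
- by move=> t /andP[rt ac]; rewrite rect_turn //= dotvC.
pose h (p : V * V * V) := (p.1.1, p.2, p.1.2).
rewrite (reindex_inj (inv_inj (_ : involutive h))) => [|[[]] //].
rewrite pair_big /= mulr_suml; under [leRHS]eq_bigr => p _ do rewrite mulr_sumr.
rewrite pair_big /= [leLHS]big_mkcond [leRHS]big_mkcond /=.
apply: ler_sum => -[[a c] b] _; rewrite /rect /uvu /=.
have := u_ge0 a; have := u_ge0 c; have := v_ge0 b.
case: (a \in S); case: (b \in S); case: (c \in S) => //= v0 u0 u1.
case: (dotv a c == g); rewrite ?andbT ?andbF ?mulr1 ?mulr0 ?mul0r //.
by case: ifP => _; rewrite ?mulr_ge0 // mulrAC.
Qed.

(** With [c] fixed and carrying [v], the fourth vertex only imposes the right angle at [c], by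
    [rectangle_fourth]. *)
Lemma energy_anisotropic :
  \sum_(t | rect t && ((dotv t.1.1 t.2 != g) && (dotv t.1.2 t.2 != g))) quad phi t <=
  \sum_(c in S) v c * \sum_(a in S | dotv a c != g) \sum_(b in S | dotv b c != g)
    u a * u b * (dotv (a - c) (b - c) == 0)%:R.
Proof.
apply: (le_trans (quad_AGM _ _ uuv_ge0 uuv_AGM)).
- move=> t /andP[rt /andP[ac bc]].
  by rewrite rect_flip //= flip_side // turn_side // ac bc.
- move=> t /andP[rt /andP[ac bc]].
  by rewrite rect_turn //= dotvC ac dotvC turn_side.
under [leRHS]eq_bigr => c _.
  rewrite mulr_sumr; under eq_bigr => a _ do rewrite mulr_sumr.
  over.
rewrite pair_big_dep /= pair_big_dep /=.
pose h (p : V * V * V) := (p.1.2, p.2, p.1.1).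
have h_bij : bijective h by exists (fun t => (t.2, t.1.1, t.1.2)) => [[[]]|[[]]].
rewrite (reindex h) /=; last exact: onW_bij.
rewrite [leLHS]big_mkcond [leRHS]big_mkcond /=.
apply: ler_sum => -[[c a] b] _; rewrite /rect /uuv /=.
have := u_ge0 a; have := u_ge0 b; have := v_ge0 c.
case aS: (a \in S); case bS: (b \in S); case cS: (c \in S) => //= v0 u0 u1;
  rewrite ?andbF //.
case: (dotv a c == g); case: (dotv b c == g); rewrite ?andbF //= ?andbT.
rewrite /fourth /= (rectangle_fourth two_neq0) //.
by case: eqP; rewrite ?mulr1 ?mulr0 // mulrC.
Qed.

End Energy.

Section EnergyBound.
Variables (R : realType) (F : finFieldType) (chi : F -> R[i]).
Hypotheses (chi0 : chi 0 = 1) (chiD : forall a b, chi (a + b) = chi a * chi b).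
Hypothesis chi_neq1 : exists a, chi a != 1.
Hypothesis two_neq0 : 2 != 0 :> F.
Variable g : F.
Hypothesis g_prim : (#|F|.-1).-primitive_root g.
Local Notation q := (#|F|%:R : R).
Local Notation r := (Num.sqrt q).

(** Three classes: side ac isotropic, else side bc isotropic, or neither. Their bounds add up with 3
    = 1 + 1 + 1 and 5 = 2 + 2 + 1. *)
Lemma energy_bound k (phi u v : 'rV[F]_(4 * k + 1) -> R) : (0 < k)%N ->
  (forall a, 0 <= phi a) -> (forall a, 0 <= u a) -> (forall a, 0 <= v a) ->
  (forall a, u a ^+ 2 * v a = phi a ^+ 4) ->
  \sum_(t | rect g t) quad phi t <=
  (3 * ((\sum_(a in sphere _ g) u a) ^+ 2 / q)
   + 5 * r ^+ (4 * k - 1) * \sum_(a in sphere _ g) u a ^+ 2) *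
  \sum_(a in sphere _ g) v a.
Proof.
move=> k0 phi0 u0 v0 uv.
have quad0 t : 0 <= quad phi t by rewrite !mulr_ge0.
set U := \sum_(a in _) u a; set N := \sum_(a in _) u a ^+ 2; set A := \sum_(a in _) v a.
have A0 : 0 <= A by apply: sumr_ge0.
have q0 : 0 < q by rewrite (lt_trans _ (card_finField_natr_gt1 R F)).
have r0 : 0 <= r ^+ (4 * k - 1) by rewrite exprn_ge0 // sqrtr_ge0.
have iso : \sum_(t | rect g t && (dotv t.1.1 t.2 == g)) quad phi t <=
    (U ^+ 2 / q + 2 * r ^+ (4 * k - 1) * N) * A.
  apply: (le_trans (energy_isotropic two_neq0 g u0 v0 uv)).
  by rewrite ler_wpM2r // (isotropic_pairs chi0 chiD chi_neq1 two_neq0 g_prim).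
have iso' : \sum_(t | rect g t && (dotv t.1.2 t.2 == g)) quad phi t <=
    (U ^+ 2 / q + 2 * r ^+ (4 * k - 1) * N) * A.
  rewrite (le_trans _ iso) // le_eqVlt; apply/orP; left; apply/eqP.
  pose h (t : 'rV[F]_(4 * k + 1) * 'rV[F]_(4 * k + 1) * 'rV[F]_(4 * k + 1)) :=
    (t.1.2, t.1.1, t.2).
  rewrite (reindex_inj (inv_inj (_ : involutive h))) => [|[[]] //].
  apply: eq_big => [t|t _]; rewrite /rect /quad /fourth /= (addrC t.1.2).
    by rewrite andbCA.
  by rewrite (mulrC (phi t.1.2)).
have aniso : \sum_(t | rect g t && ((dotv t.1.1 t.2 != g) && (dotv t.1.2 t.2 != g))) quad phi t <=
    (U ^+ 2 / q + r ^+ (4 * k - 1) * N) * A.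
  apply: (le_trans (energy_anisotropic two_neq0 g u0 v0 uv)).
  rewrite [leRHS]mulrC mulr_suml; apply: ler_sum => c cS; rewrite ler_wpM2l //.
  have d2 : (2 <= 4 * k + 1)%N by lia.
  apply: (le_trans (anisotropic_pairs chi0 chiD chi_neq1 two_neq0 u d2 cS)).
  have -> : (4 * k + 1 - 2 = 4 * k - 1)%N by lia.
  have sub (w : 'rV[F]_(4 * k + 1) -> R) : (forall a, 0 <= w a) ->
      \sum_(a in sphere _ g | dotv a c != g) w a <= \sum_(a in sphere _ g) w a.
    by move=> w0; apply: ler_sum_subpred => // a /andP[].
  apply: lerD; last by rewrite ler_wpM2l ?sub // => a; rewrite sqr_ge0.
  rewrite ler_pM2r ?invr_gt0 // ler_pXn2r ?nnegrE ?sumr_ge0 //; exact: sub.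
rewrite (bigID (fun t => dotv t.1.1 t.2 == g)) /=.
rewrite [X in _ + X](bigID (fun t => dotv t.1.2 t.2 == g)) /=.
have sub' : \sum_(t | (rect g t && (dotv t.1.1 t.2 != g)) && (dotv t.1.2 t.2 == g)) quad phi t
    <= \sum_(t | rect g t && (dotv t.1.2 t.2 == g)) quad phi t.
  by apply: ler_sum_subpred => // t /andP[/andP[-> _] ->].
have -> : \sum_(t | (rect g t && (dotv t.1.1 t.2 != g)) && (dotv t.1.2 t.2 != g)) quad phi t
    = \sum_(t | rect g t && ((dotv t.1.1 t.2 != g) && (dotv t.1.2 t.2 != g))) quad phi t.
  by apply: eq_bigl => t; rewrite andbA.
by lra.
Qed.

End EnergyBound.

(** * The fourth moment *)

Lemma norm_normc (R : rcfType) (z : R[i]) : `|z| = (Normc.normc z)%:C%C.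
Proof. by []. Qed.

Lemma normc_ge0 (R : rcfType) (z : R[i]) : 0 <= Normc.normc z.
Proof. by rewrite -ler0c -norm_normc normr_ge0. Qed.

Lemma normc_real (R : rcfType) (x : R) : 0 <= x -> Normc.normc x%:C%C = x.
Proof. by move=> x0; apply: (@complexI R); rewrite -norm_normc ger0_norm // lecR. Qed.

Lemma normcD_pow4 (R : rcfType) (z w : R[i]) :
  Normc.normc (z + w) ^+ 4 <= 8 * (Normc.normc z ^+ 4 + Normc.normc w ^+ 4).
Proof.
have := le_normcD z w; have := normc_ge0 (z + w).
have := normc_ge0 z; have := normc_ge0 w.
move: (Normc.normc _) (Normc.normc _) (Normc.normc _) => c b a a0 b0 c0 cab.
apply: (@le_trans _ _ ((b + a) ^+ 4)).
  by rewrite ler_pXn2r ?nnegrE ?addr_ge0.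
have le2 : (b + a) ^+ 2 <= 2 * (b ^+ 2 + a ^+ 2) by have := sqr_ge0 (b - a); nra.
have -> : (b + a) ^+ 4 = ((b + a) ^+ 2) ^+ 2 by rewrite -exprM.
apply: (@le_trans _ _ ((2 * (b ^+ 2 + a ^+ 2)) ^+ 2)).
  by rewrite ler_pXn2r ?nnegrE ?mulr_ge0 ?addr_ge0 ?sqr_ge0.
by have := sqr_ge0 (b ^+ 2 - a ^+ 2); nra.
Qed.

(** * Roots, and Hoelder's inequality with integer powers *)

Lemma powR_exprn (R : realType) (a : R) (s t : nat) : 0 <= a -> (0 < t)%N ->
  (a `^ (s%:R / t%:R)) ^+ t = a ^+ s.
Proof.
move=> a0 t0; rewrite -!powR_mulrn ?powR_ge0 // -powRrM divfK // pnatr_eq0.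
by rewrite -lt0n.
Qed.

Lemma real_root (R : realType) (a : R) (d : nat) : 0 <= a -> (0 < d)%N ->
  exists2 x : R, 0 <= x & x ^+ d = a.
Proof.
move=> a0 d0; exists (a `^ (1%:R / d%:R)); first exact: powR_ge0.
by rewrite powR_exprn // expr1.
Qed.

(** The induction step adds the nonnegative term (n + 1) x^n (x - y)^2. *)
Lemma young_expr (R : realDomainType) (n : nat) (x y : R) : 0 <= x -> 0 <= y ->
  n.+1%:R * x ^+ n * y <= n%:R * x ^+ n.+1 + y ^+ n.+1.
Proof.
move=> x0 y0; elim: n => [|n IH]; first by rewrite mul0r add0r expr0 expr1 !mul1r.
have := ler_wpM2r y0 IH.
have : 0 <= n.+1%:R * x ^+ n * (x - y) ^+ 2.
  by rewrite mulr_ge0 ?sqr_ge0 // mulr_ge0 ?ler0n ?exprn_ge0.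
rewrite !exprS -!natr1; nra.
Qed.

Lemma sum_expr_le (R : realType) (I : finType) (P : {set I}) (x : I -> R) (n : nat) :
  (forall i, 0 <= x i) -> 0 < \sum_(i in P) x i ^+ (n + 1) ->
  (\sum_(i in P) x i ^+ n) ^+ (n + 1) <=
  #|P|%:R * (\sum_(i in P) x i ^+ (n + 1)) ^+ n.
Proof.
rewrite addn1 => x0; set A := \sum_(i in P) x i ^+ n.+1; set U := \sum_(i in P) x i ^+ n => A0.
have P0 : 0 < #|P|%:R :> R.
  rewrite ltr0n lt0n cards_eq0; apply/eqP => P0.
  by move: A0; rewrite /A P0 big_set0 ltxx.
have U0 : 0 <= U by apply: sumr_ge0 => i _; rewrite exprn_ge0.
(* [y] is the power mean of [x], so that the terms y^(n+1) sum to [A] in Young's inequality. *)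
have [y y0 yE] := real_root (ltW (divr_gt0 A0 P0)) (ltn0Sn n).
have le1 : n.+1%:R * (U * y) <= n.+1%:R * A.
  have -> : n.+1%:R * A = \sum_(i in P) (n%:R * x i ^+ n.+1 + y ^+ n.+1).
    rewrite big_split /= -mulr_sumr sumr_const -[_ *+ #|P|]mulr_natl yE mulrCA divff ?gt_eqF //.
    by rewrite mulr1 -natr1 mulrDl mul1r.
  rewrite /U mulr_suml mulr_sumr; apply: ler_sum => i _; rewrite mulrA.
  exact: young_expr.
rewrite ler_pM2l ?ltr0n // in le1.
have : (U * y) ^+ n.+1 <= A ^+ n.+1 by rewrite ler_pXn2r ?nnegrE ?mulr_ge0 // ltW.
rewrite exprMn yE mulrA ler_pdivrMr // => le2.
by rewrite -(ler_pM2r A0) (le_trans le2) // exprSr mulrC mulrA.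
Qed.

(** * The fourth moment as a sum over rectangles *)

Section FourthMoment.
Variables (R : realType) (F : finFieldType) (chi : F -> R[i]).
Hypotheses (chi0 : chi 0 = 1) (chiD : forall a b, chi (a + b) = chi a * chi b).
Hypothesis chi_neq1 : exists a, chi a != 1.
Variables (d : nat) (g : F).
Local Notation q := (#|F|%:R : R).
Local Notation V := 'rV[F]_d.
Implicit Type h : V -> R[i].

Definition fourier h (m : V) := \sum_x chi (dotv m x) * h x.

(** The squared transform is a sum over pairs with frequency a + b; in the sum of its squared
    modulus, orthogonality forces a + b = c + e, so e is [fourth]. *)
Lemma sum_fourier_pow4 h :
  \sum_m `|fourier h m| ^+ 4 <= #|F|%:R ^+ d *
    \sum_(t : V * V * V) `|h t.1.1| * `|h t.1.2| * `|h t.2| * `|h (fourth t)|.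
Proof.
pose k (p : V * V) := h p.1 * h p.2.
have fourier2 m : fourier h m ^+ 2 = \sum_p chi (dotv m (p.1 + p.2)) * k p.
  rewrite expr2 /fourier mulr_suml; under eq_bigr => a _ do rewrite mulr_sumr.
  rewrite pair_big /=; apply: eq_bigr => p _.
  by rewrite mulrACA -chiD -dotvDr.
have ge0 : 0 <= \sum_m `|fourier h m| ^+ 4 by apply: sumr_ge0 => m _; rewrite exprn_ge0.
have E : \sum_m `|fourier h m| ^+ 4 = #|F|%:R ^+ d *
    \sum_(t : V * V * V) k t.1 * (k (t.2, fourth t))^*.
  transitivity (\sum_m \sum_p \sum_p'
      chi (dotv m (p.1 + p.2 - (p'.1 + p'.2))) * (k p * (k p')^*)).
    apply: eq_bigr => m _.
    have -> : `|fourier h m| ^+ 4 = `|fourier h m ^+ 2| ^+ 2.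
      by rewrite normrX -exprM.
    rewrite normCK fourier2 rmorph_sum mulr_suml; apply: eq_bigr => p _.
    rewrite mulr_sumr; apply: eq_bigr => p' _.
    by rewrite /= rmorphM /= (conj_chi chi0 chiD) mulrACA -chiD dotvBr.
  rewrite exchange_big /= mulr_sumr -(pair_bigA _ (fun p c =>
    #|F|%:R ^+ d * (k p * (k (c, fourth (p, c)))^*))) /=.
  apply: eq_bigr => p _; rewrite exchange_big /=.
  rewrite -(pair_bigA _ (fun c e => \sum_m chi (dotv m (p.1 + p.2 - (c + e))) *
    (k p * (k (c, e))^*))) /=.
  apply: eq_bigr => c _.
  under eq_bigr => e _ do
    rewrite -mulr_suml (sum_char_dotv chi0 chiD chi_neq1) opprD addrA subr_eq0.
  rewrite (bigD1 (fourth (p, c))) //= eqxx mulr1 big1 ?addr0 // => e.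
  by rewrite eq_sym /fourth /= => /negPf ->; rewrite mulr0 mul0r.
rewrite E in ge0 *; rewrite -[leLHS](ger0_norm ge0).
rewrite normrM normrX normr_nat ler_wpM2l ?exprn_ge0 //.
apply: (le_trans (ler_norm_sum _ _ _)); apply: ler_sum => t _.
by rewrite normrM norm_conjC /k /= !normrM !mulrA.
Qed.

Lemma sum_fourier_sphere_pow4 h : (forall a, a \notin sphere d g -> h a = 0) ->
  \sum_m Normc.normc (fourier h m) ^+ 4 <=
  q ^+ d * \sum_(t | rect g t) quad (fun a => Normc.normc (h a)) t.
Proof.
move=> h0; have := sum_fourier_pow4 h.
have -> : \sum_(t : V * V * V) `|h t.1.1| * `|h t.1.2| * `|h t.2| * `|h (fourth t)| =
    (\sum_(t | rect g t) quad (fun a => Normc.normc (h a)) t)%:C%C.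
  rewrite rmorph_sum /= [RHS]big_mkcond /=; apply: eq_bigr => t _.
  rewrite !norm_normc -!rmorphM /rect /=.
  case: ifP => // /negbT; rewrite !negb_and => /or4P[] /h0 ->;
    by rewrite Normc.normc0 ?(mul0r, mulr0).
under eq_bigr => m _ do rewrite norm_normc -rmorphXn.
by rewrite -rmorph_sum -[#|F|%:R](rmorph_nat (real_complex R)) -rmorphXn -rmorphM lecR.
Qed.

End FourthMoment.

(** * The restriction estimate *)

Lemma exprD_le (R : realDomainType) (n : nat) (x y : R) : 0 <= x -> 0 <= y ->
  (x + y) ^+ n <= 2 ^+ n * (x ^+ n + y ^+ n).
Proof.
move=> x0 y0; have [xy | /ltW yx] := leP x y.
  apply: (@le_trans _ _ ((2 * y) ^+ n)).
    by apply: lerXn2r; rewrite ?nnegrE ?addr_ge0 ?mulr_ge0 //; lra.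
  by rewrite exprMn ler_wpM2l ?exprn_ge0 // lerDr exprn_ge0.
apply: (@le_trans _ _ ((2 * x) ^+ n)).
  by apply: lerXn2r; rewrite ?nnegrE ?addr_ge0 ?mulr_ge0 //; lra.
by rewrite exprMn ler_wpM2l ?exprn_ge0 // lerDl exprn_ge0.
Qed.

Section RestrictionEstimate.
Variables (R : realType) (F : finFieldType) (chi : F -> R[i]).
Hypotheses (chi0 : chi 0 = 1) (chiD : forall a b, chi (a + b) = chi a * chi b).
Hypothesis chi_neq1 : exists a, chi a != 1.
Hypothesis two_neq0 : 2 != 0 :> F.
Variable g : F.
Hypothesis g_prim : (#|F|.-1).-primitive_root g.
Variable k : nat.
Hypothesis k_gt0 : (0 < k)%N.
Local Notation q := (#|F|%:R : R).
Local Notation r := (Num.sqrt q).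
Local Notation d := (4 * k + 1)%N.
Local Notation V := 'rV[F]_d.
Local Notation S := (sphere d g).
Local Notation n := (#|S|%:R : R).

Variables (h : V -> R[i]) (x : V -> R).
Hypotheses (h_out : forall a, a \notin S -> h a = 0) (x_ge0 : forall a, 0 <= x a).
Hypothesis xh : forall a, x a ^+ (12 * k + 1) = Normc.normc (h a) ^+ 4.

(** As 12k + 1 = 3d - 2, [x] is |h|^(4/(3d-2)) and [A] sums |h|^p for p = 4d/(3d-2); [U] sums the
    weights x^(d-1), and [Q] is q^((d-2)/2). *)
Let A := \sum_(a in S) x a ^+ d.
Let U := \sum_(a in S) x a ^+ (4 * k).
Let Q := r ^+ (4 * k - 1).

Let q_gt0 : 0 < q.
Proof. by rewrite (lt_trans _ (card_finField_natr_gt1 R F)). Qed.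

Let Q_gt0 : 0 < Q. Proof. by rewrite exprn_gt0 // sqrtr_gt0. Qed.

Let A_ge0 : 0 <= A. Proof. by apply: sumr_ge0 => a _; rewrite exprn_ge0. Qed.

Let h_cut (P : pred V) a := if P a then h a else 0.
Let x_cut (P : pred V) a := if P a then x a else 0.

Let x_cut_ge0 P a : 0 <= x_cut P a.
Proof. by rewrite /x_cut; case: ifP. Qed.

Let x_cut_le P a : x_cut P a <= x a.
Proof. by rewrite /x_cut; case: ifP. Qed.

Let cut_exponents P a :
  (x_cut P a ^+ (4 * k)) ^+ 2 * x_cut P a ^+ d = Normc.normc (h_cut P a) ^+ 4.
Proof.
rewrite /x_cut /h_cut -exprM -exprD.
have -> : (4 * k * 2 + (4 * k + 1) = 12 * k + 1)%N by lia.
by case: ifP => _; rewrite ?xh // Normc.normc0 !expr0n addn1.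
Qed.

Let sum_cut_le P j : \sum_(a in S) x_cut P a ^+ j <= \sum_(a in S) x a ^+ j.
Proof.
apply: ler_sum => a _; apply: lerXn2r; rewrite ?nnegrE //.
Qed.

Let fourier_cut P : \sum_m Normc.normc (fourier chi (h_cut P) m) ^+ 4 <=
  q ^+ d * \sum_(t | rect g t) quad (fun a => Normc.normc (h_cut P a)) t.
Proof.
apply: (sum_fourier_sphere_pow4 chi0 chiD chi_neq1) => a aS.
by rewrite /h_cut h_out //; case: ifP.
Qed.

Section Threshold.
Variable l : R.
(* This value of [l] balances the bounds for the small and the large part of [h]. *)
Hypotheses (l_gt0 : 0 < l) (l_expr : l ^+ d = A / Q).
Let Y := A ^+ 2 / l ^+ 2.

(** Where x <= l, x^(2(d-1)) <= l^(d-2) x^d, so the quadratic term is at most Q l^(d-2) A, which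
    equals [Y] as l^d = A / Q. *)
Let small_energy :
  \sum_(t | rect g t) quad (fun a => Normc.normc (h_cut (fun a => x a <= l) a)) t <=
  (3 * (U ^+ 2 / q) + 5 * Y) * A.
Proof.
set P := fun a => x a <= l.
apply: (le_trans (energy_bound chi0 chiD chi_neq1 two_neq0 g_prim k_gt0
  (fun a => normc_ge0 (h_cut P a)) (fun a => exprn_ge0 (4 * k) (x_cut_ge0 P a))
  (fun a => exprn_ge0 d (x_cut_ge0 P a)) (cut_exponents P))).
have UP0 : 0 <= \sum_(a in S) x_cut P a ^+ (4 * k).
  by apply: sumr_ge0 => a _; rewrite exprn_ge0.
have NP0 : 0 <= \sum_(a in S) (x_cut P a ^+ (4 * k)) ^+ 2.
  by apply: sumr_ge0 => a _; rewrite sqr_ge0.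
have NPY : Q * (\sum_(a in S) (x_cut P a ^+ (4 * k)) ^+ 2) <= Y.
  rewrite /Y ler_pdivlMr ?exprn_gt0 // -mulrA -ler_pdivlMl //.
  have -> : Q^-1 * A ^+ 2 = l ^+ d * A by rewrite l_expr; ring.
  have -> : l ^+ d = l ^+ (4 * k - 1) * l ^+ 2 by rewrite -exprD; congr (_ ^+ _); lia.
  rewrite mulrAC ler_pM2r ?exprn_gt0 // /A mulr_sumr; apply: ler_sum => a _.
  rewrite /x_cut -exprM; have -> : (4 * k * 2 = 4 * k - 1 + (4 * k + 1))%N by lia.
  rewrite exprD; case: ifP => [Pa|_].
    rewrite ler_wpM2r ?exprn_ge0 //; apply: lerXn2r; rewrite ?nnegrE // ltW //.
  by rewrite [0 ^+ d]expr0n addn1 mulr0 mulr_ge0 ?exprn_ge0 // ltW.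
apply: ler_pM.
- by rewrite addr_ge0 ?mulr_ge0 ?sqr_ge0 ?invr_ge0 ?ler0n // ltW.
- by apply: sumr_ge0 => a _; rewrite exprn_ge0.
- rewrite -[5 * _ * _]mulrA lerD ?ler_pM2l // ler_pM2r ?invr_gt0 //.
  by rewrite ler_pXn2r ?nnegrE ?(le_trans UP0) ?sum_cut_le.
- exact: sum_cut_le.
Qed.

(** Where x > l, x^(d-1) <= x^d / l, so the weights [u] sum to at most A / l, whose square is
    [Y]. *)
Let large_energy :
  \sum_(t | rect g t) quad (fun a => Normc.normc (h_cut (fun a => l < x a) a)) t <=
  Y * A.
Proof.
set P := fun a => l < x a.
apply: (le_trans (energy_trivial g
  (fun a => exprn_ge0 (4 * k) (x_cut_ge0 P a))
  (fun a => exprn_ge0 d (x_cut_ge0 P a)) (cut_exponents P))).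
have UP0 : 0 <= \sum_(a in S) x_cut P a ^+ (4 * k).
  by apply: sumr_ge0 => a _; rewrite exprn_ge0.
apply: ler_pM; [exact: sqr_ge0 | by apply: sumr_ge0 => a _; rewrite exprn_ge0 | |
  exact: sum_cut_le].
rewrite /Y -expr_div_n ler_pXn2r ?nnegrE ?divr_ge0 // ?(ltW l_gt0) //.
rewrite ler_pdivlMr // mulr_suml; apply: ler_sum => a _.
rewrite addn1 exprSr /x_cut; case: ifP => [/ltW Pa|_].
  by rewrite ler_wpM2l ?exprn_ge0.
(* Off the cut the term is 0 ^ (4k), which vanishes because k > 0. *)
by rewrite expr0n muln_eq0 /= eqn0Ngt k_gt0 mul0r mulr_ge0 ?exprn_ge0.
Qed.

(** 48 = 8 (5 + 1): the 8 is from [normcD_pow4], and 5 + 1 adds the coefficients of [Y] in the two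
    energies. *)
Lemma fourier_pow4_threshold :
  \sum_m Normc.normc (fourier chi h m) ^+ 4 <= 48 * q ^+ d * A * (U ^+ 2 / q + Y).
Proof.
pose P1 a := x a <= l; pose P2 a := l < x a.
have fourierD m : fourier chi h m = fourier chi (h_cut P1) m + fourier chi (h_cut P2) m.
  rewrite -big_split; apply: eq_bigr => a _; rewrite /= -mulrDr /h_cut /P1 /P2.
  by rewrite ltNge; case: ifP; rewrite /= ?addr0 ?add0r.
apply: (@le_trans _ _ (8 * (\sum_m Normc.normc (fourier chi (h_cut P1) m) ^+ 4 +
    \sum_m Normc.normc (fourier chi (h_cut P2) m) ^+ 4))).
  rewrite -big_split mulr_sumr; apply: ler_sum => m _.
  by rewrite fourierD normcD_pow4.
have qd : 0 < q ^+ d by rewrite exprn_gt0.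
have le1 := le_trans (fourier_cut P1) (ler_wpM2l (ltW qd) small_energy).
have le2 := le_trans (fourier_cut P2) (ler_wpM2l (ltW qd) large_energy).
have : 0 <= q ^+ d * A * (U ^+ 2 / q).
  by rewrite mulr_ge0 ?divr_ge0 ?sqr_ge0 ?(ltW q_gt0) // mulr_ge0 // ltW.
by move: le1 le2; move: (U ^+ 2 / q) Y (q ^+ d) => X Z w; lra.
Qed.

(** The power [d] removes the root hidden in [l], making Y^d a monomial in [A] and [q]. *)
Lemma fourier_pow4_expr : 0 < A ->
  (\sum_m Normc.normc (fourier chi h m) ^+ 4) ^+ d <=
  192 ^+ d * 5 * n ^+ (d + 2) * A ^+ (12 * k + 1).
Proof.
move=> A0; have card_ge := card_sphere_ge chi0 chiD chi_neq1 two_neq0 g_prim k_gt0.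
have n0 : 0 <= n by [].
have Y0 : 0 <= Y by rewrite divr_ge0 ?sqr_ge0.
have X0 : 0 <= U ^+ 2 / q by rewrite divr_ge0 ?sqr_ge0 // ltW.
have U0 : 0 <= U by apply: sumr_ge0 => a _; rewrite exprn_ge0.
have M0 : 0 <= \sum_m Normc.normc (fourier chi h m) ^+ 4.
  by apply: sumr_ge0 => m _; rewrite exprn_ge0 ?normc_ge0.
(* Hoelder gives U^d <= n A^(d-1). *)
have le_X : q ^+ d * (U ^+ 2 / q) ^+ d <= n ^+ 2 * A ^+ (8 * k).
  rewrite -exprMn mulrCA divff ?gt_eqF // mulr1 -exprM mulnC exprM.
  have -> : n ^+ 2 * A ^+ (8 * k) = (n * A ^+ (4 * k)) ^+ 2.
    have -> : (8 * k = 4 * k * 2)%N by move: k_gt0; clear; lia.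
    by rewrite exprMn -exprM.
  apply: lerXn2r; rewrite ?nnegrE ?exprn_ge0 ?mulr_ge0 ?exprn_ge0 //.
  exact: sum_expr_le.
(* The left side equals q^(8k) A^(8k), and q^(4k) <= 2 n trades [q] for the size of the sphere. *)
have le_Y : q ^+ d * Y ^+ d <= 4 * (n ^+ 2 * A ^+ (8 * k)).
  have -> : Y ^+ d = A ^+ (8 * k) * q ^+ (4 * k - 1).
    rewrite expr_div_n -!exprM (mulnC 2%N) (exprM l) l_expr expr_div_n.
    have -> : (d * 2 = 8 * k + 2)%N by move: k_gt0; clear; lia.
    rewrite exprD.
    have <- : Q ^+ 2 = q ^+ (4 * k - 1).
      by rewrite /Q -exprM mulnC exprM sqr_sqrtr // ltW.
    by field; rewrite !gt_eqF.
  have -> : q ^+ d * (A ^+ (8 * k) * q ^+ (4 * k - 1)) = (q ^+ (4 * k)) ^+ 2 * A ^+ (8 * k).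
    rewrite mulrCA mulrC -exprD -exprM.
    by have -> : (4 * k + 1 + (4 * k - 1) = 4 * k * 2)%N by move: k_gt0; clear; lia.
  rewrite mulrA ler_pM2r ?exprn_gt0 //.
  have -> : 4 * n ^+ 2 = (2 * n) ^+ 2 by ring.
  by apply: lerXn2r; rewrite ?nnegrE ?exprn_ge0 ?mulr_ge0 // ltW.
apply: (@le_trans _ _ ((48 * q ^+ d * A * (U ^+ 2 / q + Y)) ^+ d)).
  apply: lerXn2r; rewrite ?nnegrE //; last exact: fourier_pow4_threshold.
  by rewrite !mulr_ge0 ?addr_ge0 ?exprn_ge0 // ltW.
rewrite !exprMn.
have le_XY : (U ^+ 2 / q + Y) ^+ d * q ^+ d <= 2 ^+ d * (5 * (n ^+ 2 * A ^+ (8 * k))).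
  apply: (le_trans (ler_wpM2r _ (exprD_le d X0 Y0))); first by rewrite exprn_ge0 // ltW.
  by rewrite -mulrA ler_pM2l ?exprn_gt0 //; move: le_X le_Y; lra.
have -> : (q ^+ d) ^+ d = (q ^+ (4 * k)) ^+ d * q ^+ d.
  by rewrite -!exprM -exprD; congr (_ ^+ _); move: k_gt0; clear; lia.
have le_q : (q ^+ (4 * k)) ^+ d <= (2 * n) ^+ d.
  by apply: lerXn2r; rewrite ?nnegrE ?mulr_ge0 ?exprn_ge0 // ltW.
(* In 192 = 48 * 2 * 2, one 2 is from [card_sphere_ge] and one from [exprD_le]; 5 = 1 + 4 is from
   [le_X] and [le_Y]. *)
have -> : 192 ^+ d * 5 * n ^+ (d + 2) * A ^+ (12 * k + 1) =
    48 ^+ d * A ^+ d * ((2 * n) ^+ d * (2 ^+ d * (5 * (n ^+ 2 * A ^+ (8 * k))))).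
  have -> : 192 = 48 * 2 * 2 :> R by ring.
  have -> : A ^+ (12 * k + 1) = A ^+ d * A ^+ (8 * k).
    by rewrite -exprD; congr (_ ^+ _); move: k_gt0; clear; lia.
  by rewrite (exprMn _ (48 * 2)) (exprMn _ 48) (exprMn _ 2 n) (exprD n d 2); ring.
have -> : 48 ^+ d * ((q ^+ (4 * k)) ^+ d * q ^+ d) * A ^+ d * (U ^+ 2 / q + Y) ^+ d =
  48 ^+ d * A ^+ d * ((q ^+ (4 * k)) ^+ d * ((U ^+ 2 / q + Y) ^+ d * q ^+ d)) by ring.
rewrite ler_pM2l ?mulr_gt0 ?exprn_gt0 //; apply: ler_pM => //.
  by rewrite !exprn_ge0 // ltW.
by rewrite mulr_ge0 // ?exprn_ge0 ?addr_ge0 // ltW.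
Qed.

End Threshold.

(** If A = 0 there is no positive threshold, but then [x], and with it [h], vanishes identically on
    the sphere. *)
Lemma fourier_pow4_bound :
  (\sum_m Normc.normc (fourier chi h m) ^+ 4) ^+ d <=
  192 ^+ d * 5 * n ^+ (d + 2) * A ^+ (12 * k + 1).
Proof.
have [A0 | A0] := ltP 0 A.
  have [|l l0 lE] := @real_root R (A / Q) d _ (ltn_addl _ (ltn0Sn 0)).
    by rewrite divr_ge0 // ltW.
  apply: (@fourier_pow4_expr l) => //.
  rewrite lt_def l0 andbT; apply/eqP => l00; move: lE; rewrite l00 expr0n addn1 /=.
  by move/eqP; rewrite eq_sym gt_eqF // divr_gt0.
have h0 a : h a = 0.
  have [aS | /h_out //] := boolP (a \in S).
  have /eqP : \sum_(b in S) x b ^+ d = 0 by apply/eqP; rewrite eq_le A0 A_ge0.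
  rewrite psumr_eq0 => [/allP /(_ a)|b _]; last by rewrite exprn_ge0.
  rewrite mem_index_enum aS expf_eq0 addn1 /= => /(_ isT) /eqP xa0.
  apply: Normc.eq0_normc; have /eqP := xh a.
  by rewrite xa0 expr0n addn1 eq_sym expf_eq0 => /eqP.
rewrite big1 => [|m _]; first by rewrite expr0n addn1 /= !mulr_ge0 ?exprn_ge0.
rewrite [fourier _ _ _]big1 ?Normc.normc0 ?expr0n // => a _.
by rewrite h0 mulr0.
Qed.

End RestrictionEstimate.

(* For d = 4k+1, R*_{S_g}(4d/(3d-2) -> 4) is bounded by a constant C
   independent of q (i.e. of the finite field F of odd order q), of the
   primitive element g and of the nontrivial additive character chi. *)
Theorem theorem1p10 (R : realType) (k : nat) (hk : (0 < k)%N) :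
  exists C : R,
    forall (F : finFieldType) (chi : F -> R[i]) (g : F),
      odd #|F| ->
      (#|F|.-1).-primitive_root g ->
      nontrivial_additive_char chi ->
      forall f : 'rV[F]_(4 * k + 1) -> R[i],
        norm_dc 4%:R (ext_op chi (sphere (4 * k + 1) g) f)
        <= C * norm_dsigma ((4 * (4 * k + 1))%N%:R / (3 * (4 * k + 1) - 2)%N%:R)
                 (sphere (4 * k + 1) g) f.
Proof.
have e1 : (3 * (4 * k + 1) - 2 = 12 * k + 1)%N by move: hk; clear; lia.
(* 6 suffices because 6^4 = 1296 >= 960 = 192 * 5. *)
exists 6 => F chi g /finField_two_neq0 two_neq0 g_prim [chi0 [chiD chi_neq1]] f.
rewrite e1; set S := sphere _ g; set n : R := #|S|%:R.
(* Both norms see only the values of [f] on the sphere. *)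
pose h a := if a \in S then f a else 0.
pose x a := Normc.normc (h a) `^ (4%:R / (12 * k + 1)%:R).
have x0 a : 0 <= x a by exact: powR_ge0.
have h_out a : a \notin S -> h a = 0 by rewrite /h => /negPf ->.
have t0 : (0 < 12 * k + 1)%N by rewrite addn1.
have xh a : x a ^+ (12 * k + 1) = Normc.normc (h a) ^+ 4.
  by rewrite powR_exprn // normc_ge0.
have n0 : 0 < n.
  have := card_sphere_ge chi0 chiD chi_neq1 two_neq0 g_prim hk.
  rewrite -/S -/n => le_n; rewrite -(@pmulr_rgt0 _ 2) // (lt_le_trans _ le_n) //.
  by rewrite exprn_gt0 // (lt_trans _ (card_finField_natr_gt1 R F)).
have := fourier_pow4_bound chi0 chiD chi_neq1 two_neq0 g_prim hk h_out x0 xh.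
rewrite -/S -/n; set M := \sum_m _; set A := \sum_(a in S) _ => le_M.
have A0 : 0 <= A by apply: sumr_ge0 => a _; rewrite exprn_ge0.
have M0 : 0 <= M by apply: sumr_ge0 => m _; rewrite exprn_ge0 ?normc_ge0.
have d0 : (0 < 4 * (4 * k + 1))%N by rewrite muln_gt0 addn1.
have -> : norm_dsigma ((4 * (4 * k + 1))%N%:R / (12 * k + 1)%N%:R) S f =
    (n^-1 * A) `^ ((12 * k + 1)%:R / (4 * (4 * k + 1))%:R).
  rewrite /norm_dsigma invf_div; congr ((_ * _) `^ _); apply: eq_bigr => a aS.
  by rewrite -powR_mulrn ?x0 // -powRrM mulrAC -natrM /h aS.
have -> : norm_dc 4%:R (ext_op chi S f) = (n^-1 ^+ 4 * M) `^ (1%:R / 4%:R).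
  rewrite /norm_dc div1r; congr (_ `^ _); rewrite mulr_sumr; apply: eq_bigr => m _.
  rewrite powR_mulrn ?normc_ge0 //.
  have -> : ext_op chi S f m = n%:C%C^-1 * fourier chi h m.
    rewrite /ext_op /n rmorph_nat; congr (_ * _); rewrite big_mkcond.
    by apply: eq_bigr => a _; rewrite /h; case: ifP; rewrite ?mulr0.
  by rewrite Normc.normcM Normc.normcV normc_real ?(ltW n0) // exprMn.
(* The power 4d makes all exponents integers: (n^-4 M)^d against 6^(4d) (A / n)^(3d-2). *)
rewrite -(ler_pXn2r d0) ?nnegrE ?mulr_ge0 ?powR_ge0 //.
have nV0 : 0 <= n^-1 by rewrite invr_ge0 ltW.
rewrite exprMn powR_exprn ?mulr_ge0 // exprM powR_exprn ?mulr_ge0 ?exprn_ge0 //.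
rewrite expr1 exprMn -exprM exprMn.
apply: (le_trans (ler_wpM2l _ le_M)); first by rewrite exprn_ge0.
(* 4d = (3d - 2) + (d + 2), and the second part cancels n^(d+2). *)
have -> : n^-1 ^+ (4 * (4 * k + 1)) = n^-1 ^+ (12 * k + 1) * n^-1 ^+ (4 * k + 1 + 2).
  by rewrite -exprD; congr (_ ^+ _); clear; lia.
have nV : n^-1 ^+ (4 * k + 1 + 2) * n ^+ (4 * k + 1 + 2) = 1.
  by rewrite -exprMn mulVf ?gt_eqF // expr1n.
have c_le : 192 ^+ (4 * k + 1) * 5 <= 6 ^+ (4 * (4 * k + 1)) :> R.
  have le6 : (192 * 5) ^+ (4 * k + 1) <= 6 ^+ (4 * (4 * k + 1)) :> R.
    by rewrite [leRHS]exprM; apply: lerXn2r; rewrite ?nnegrE ?mulr_ge0 ?exprn_ge0 //; lra.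
  apply: le_trans le6; rewrite exprMn ler_wpM2l ?exprn_ge0 //.
  by rewrite addn1 exprS ler_peMr // exprn_ege1 //; lra.
have -> : n^-1 ^+ (12 * k + 1) * n^-1 ^+ (4 * k + 1 + 2) *
    (192 ^+ (4 * k + 1) * 5 * n ^+ (4 * k + 1 + 2) * A ^+ (12 * k + 1)) =
    (192 ^+ (4 * k + 1) * 5) * (n^-1 ^+ (12 * k + 1) * A ^+ (12 * k + 1)) *
    (n^-1 ^+ (4 * k + 1 + 2) * n ^+ (4 * k + 1 + 2)) by ring.
rewrite nV mulr1; apply: ler_wpM2r => //.
by rewrite mulr_ge0 ?exprn_ge0 ?invr_ge0 // ltW.
Qed.
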